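(* Let $d\ge4$ be an even integer, let $p,m\in\mathbb{N}_0$ with $m\ge p+1$, and let $\mathbf{x},\mathbf{x}'\in\mathbb{R}^d$ be given in standard polyspherical coordinates, with $r,r',R,R'>0$ and $r\ne r'$. Then $$\begin{aligned} Q_{m-\frac12}^{p+\frac12}(\chi)&=(-1)^{\frac d2-1}(2\pi)^{\frac d2-1}(\zeta^2-1)^{\frac p2+\frac{d-1}4}(\chi^2-1)^{-\frac p2-\frac14}\frac{(p+m)!}{(m-p-1)!}\left(\frac{rr'}{RR'}\right)^p\\ &\times\sum_{l_{d-2}=m}^\infty\Omega_{d-2}(l_{d-2},m)\sum_{l_{d-3}=l_{d-2}}^\infty\Omega_{d-3}(l_{d-3},l_{d-2})\cdots\sum_{l_1=l_2}^\infty\Omega_1(l_1,l_2)\,\frac{(l_1-p-1)!}{(p+l_1+d-2)!}\,Q_{l_1+\frac{d-3}2}^{p+\frac{d-1}2}(\zeta). \end{aligned}$$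
   Context: $\mathbb{N}_0=\{0,1,2,\ldots\}$. Standard polyspherical coordinates on $\mathbb{R}^d$: $x_j=r\sin\theta_1\cdots\sin\theta_{j-1}\cos\theta_j$ for $1\le j\le d-2$, $x_{d-1}=R\cos\phi$, $x_d=R\sin\phi$, where $R=r\sin\theta_1\cdots\sin\theta_{d-2}$, $r\ge0$, $\theta_j\in[0,\pi]$, $\phi\in[-\pi,\pi)$; primed quantities refer to $\mathbf{x}'$. Put $$\zeta=\frac{r^2+r'^2}{2rr'},\qquad \chi=\frac{R^2+R'^2+\sum_{j=1}^{d-2}(x_j-x_j')^2}{2RR'}.$$ For $1\le j\le d-2$ and integers $l_j\ge l_{j+1}\ge0$ (with $l_{d-1}:=m$) put $\Omega_j(l_j,l_{j+1}):=\Theta_j^d(l_j,l_{j+1};\theta_j)\,\Theta_j^d(l_j,l_{j+1};\theta_j')$, where $$\Theta_j^d(l_j,l_{j+1};\theta)=\frac{\Gamma\!\left(l_{j+1}+\frac{d-j+1}2\right)}{2l_{j+1}+d-j-1}\sqrt{\frac{2^{2l_{j+1}+d-j-1}(2l_j+d-j-1)(l_j-l_{j+1})!}{\pi\,(l_j+l_{j+1}+d-j-2)!}}\,(\sin\theta)^{l_{j+1}}\,C_{l_j-l_{j+1}}^{l_{j+1}+(d-j-1)/2}(\cos\theta)$$ and $C_n^\mu$ is the Gegenbauer polynomial. For $z>1$ the associated Legendre function of the second kind is $$Q_\nu^\mu(z)=\frac{\sqrt{\pi}\,e^{i\pi\mu}\,\Gamma(\nu+\mu+1)(z^2-1)^{\mu/2}}{2^{\nu+1}\Gamma(\nu+\frac32)z^{\nu+\mu+1}}\,{}_2F_1\!\left(\tfrac{\nu+\mu+1}{2},\tfrac{\nu+\mu+2}{2};\nu+\tfrac32;\tfrac1{z^2}\right).$$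 *)

(* Defs.v *)
From mathcomp Require Import all_boot all_order all_algebra.
From mathcomp Require Import complex.
From mathcomp Require Import all_classical all_reals all_analysis.

Set Implicit Arguments.
Unset Strict Implicit.
Unset Printing Implicit Defensive.

Import Order.TTheory GRing.Theory Num.Theory.
Import numFieldNormedType.Exports.

Local Open Scope classical_set_scope.
Local Open Scope ring_scope.
Local Open Scope complex_scope.

Section SpecialFunctions.
Context {R : realType}.

(* Euler's integral; only used for x > 0, where it converges. *)
Definition Gamma (x : R) : R :=
  \int[lebesgue_measure]_(t in `]0%R, +oo[) (t `^ (x - 1) * expR (- t)).

Definition pochhammer (a : R) (n : nat) : R := \prod_(0 <= k < n) (a + k%:R).

(* The Gauss series; only used for |z| < 1 and c > 0, where it converges. *)
Definition hyp2F1 (a b c z : R) : R :=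
  limn (series (fun n : nat =>
    pochhammer a n * pochhammer b n / (pochhammer c n * n`!%:R) * z ^+ n)).

Definition gegenbauer (n : nat) (mu x : R) : R :=
  \sum_(0 <= k < n./2.+1)
    (-1) ^+ k * pochhammer mu (n - k) / (k`!%:R * (n - k.*2)`!%:R)
    * (x *+ 2) ^+ (n - k.*2).

Definition cis (t : R) : R[i] := cos t +i* sin t.

Definition legendreQ (nu mu z : R) : R[i] :=
  cis (pi * mu) *
  (Num.sqrt pi * Gamma (nu + mu + 1) * (z ^+ 2 - 1) `^ (mu / 2)
   / (2 `^ (nu + 1) * Gamma (nu + 3 / 2) * z `^ (nu + mu + 1))
   * hyp2F1 ((nu + mu + 1) / 2) ((nu + mu + 2) / 2) (nu + 3 / 2)
            (1 / z ^+ 2))%:C.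

End SpecialFunctions.

Section Polyspherical.
Context {R : realType}.

(* A family of angles is a function theta : nat -> R, of which only the values
   theta 1, ..., theta (d - 2) matter. *)
Definition polyR (d : nat) (r : R) (theta : nat -> R) : R :=
  r * \prod_(1 <= k < d.-1) sin (theta k).

(* Ordinals count from 0: the coordinate x_j is the entry of index j - 1. *)
Definition polyspherical (d : nat) (r : R) (theta : nat -> R) (phi : R)
    : 'rV[R]_d :=
  \row_(i < d)
    let j := i.+1 in
    if (j <= d - 2)%N then
      r * (\prod_(1 <= k < j) sin (theta k)) * cos (theta j)
    else if j == d.-1 then polyR d r theta * cos phi
    else polyR d r theta * sin phi.

Definition zeta (r r' : R) : R := (r ^+ 2 + r' ^+ 2) / (2 * r * r').

Definition chi (d : nat) (rho rho' : R) (x x' : 'rV[R]_d) : R :=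
  (rho ^+ 2 + rho' ^+ 2
     + \sum_(i < d | (i < d - 2)%N) (x 0 i - x' 0 i) ^+ 2)
  / (2 * rho * rho').

(* Theta_j^d(l, l'; t), used for 1 <= j <= d - 2 and l' <= l, so that all the
   natural number subtractions are exact. *)
Definition Theta (d j l l' : nat) (t : R) : R :=
  let N := (2 * l' + d - j - 1)%N in
  Gamma (l'%:R + (d - j + 1)%N%:R / 2) / N%:R
  * Num.sqrt (2 ^+ N * (2 * l + d - j - 1)%N%:R * (l - l')`!%:R
              / (pi * (l + l' + d - j - 2)`!%:R))
  * sin t ^+ l'
  * gegenbauer (l - l') (l'%:R + (d - j - 1)%N%:R / 2) (cos t).

Definition Omega (d : nat) (theta theta' : nat -> R) (j l l' : nat) : R :=
  Theta d j l l' (theta j) * Theta d j l l' (theta' j).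

End Polyspherical.

(* [is_iterated_series w a n l s]: the iterated series
     \sum_(l_n >= l) w n l_n l * \sum_(l_(n-1) >= l_n) w (n-1) l_(n-1) l_n * ...
       * \sum_(l_1 >= l_2) w 1 l_1 l_2 * a l_1
   converges, at every level of nesting, and has sum s. The topology of C comes
   from its regular module structure C^o. *)
Fixpoint is_iterated_series (R : realType) (w : nat -> nat -> nat -> R)
    (a : nat -> R[i]) (n l : nat) (s : R[i]) : Prop :=
  if n is n'.+1 then
    exists2 u : nat -> R[i],
      forall k, (l <= k)%N -> is_iterated_series w a n' k (u k)
    & (fun N => \sum_(l <= k < N) (w n k l)%:C * u k : R[i]^o) @ \oo
        --> (s : R[i]^o)
  else s = a l.

(* Main.v *)
(** Euler's transformation writes (z^2 - 1)^(mu/2) Q_nu^mu(z), up to Gamma factors,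
    as the series H(a, c; z) = sum_k (a)_2k / (4^k k! (c)_k) z^(-a-2k) with
    a = nu - mu + 1 and c = nu + 3/2. Put z_0 = zeta and
    z_j = (z_(j-1) - cos theta_j cos theta'_j) / (sin theta_j sin theta'_j), so that
    z_(d-2) = chi. Each of the d - 2 summations is then one addition theorem,
    which expands H(a, mu + 1/2; (z - x y) / s), s^2 = (1 - x^2) (1 - y^2), into
    the H(a + n, mu + n + 1; z) with coefficients C_n^mu(x) C_n^mu(y). Expanding
    both sides in powers of 1/z, it amounts to a polynomial identity in x and y for
    each power, whose two sides satisfy the same recurrence under the Gegenbauer
    operator in x and agree at x = 1. Applied with x = y, the same identity
    dominates the double series absolutely, so that they may be rearranged. *)

Require Import Defs.
From mathcomp Require Import all_boot all_order all_algebra.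
From mathcomp Require Import complex.
From mathcomp Require Import all_classical all_reals all_analysis.
From mathcomp Require Import measurable_realfun.
From mathcomp Require Import zify ring lra.

Import Order.TTheory GRing.Theory Num.Theory.
Import numFieldNormedType.Exports.
Local Open Scope ring_scope.

Set Implicit Arguments.
Unset Strict Implicit.
Unset Printing Implicit Defensive.

(** The addition theorem comes from an average. For the probability density proportional to (1 -
    u^2)^(mu - 1) on [-1, 1], H(a, mu + 1/2; w) is the mean of (w - u)^(-a). With w = (z - x y) / s,
    dividing by s^a gives the mean of (z - (x y + s u))^(-a), whose coefficient of z^(-a-N) is (a)_N
    / N! times the mean of (x y + s u)^N. No integral over u is formed: only the even moments of u
    survive, and [gegenbauer_avg] writes them out. The lower exponent a is the one to keep because
    for the summation index l it is l - p, whatever the dimension. Hence one family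
    [addition_kernel] with a dimension index e reaches both ends: e = d - 2 at zeta and e = 0 at
    chi. All parameters are integers or half-integers, so the values of Gamma are obtained from
    Gaussian moments. The parity of d enters through the phases: the orders p + (d - 1) / 2 and p +
    1 / 2 differ by the integer d / 2 - 1, whence the sign. *)

Section Pochhammer.
Context {R : realType}.
Implicit Types (a b : R) (m n : nat).

(** * Rising factorials *)

Lemma pochhammer0 a : pochhammer a 0 = 1.
Proof. by rewrite /pochhammer big_geq. Qed.

Lemma pochhammerS a n : pochhammer a n.+1 = pochhammer a n * (a + n%:R).
Proof. by rewrite /pochhammer big_nat_recr. Qed.

Lemma pochhammerD a m n :
  pochhammer a (m + n) = pochhammer a m * pochhammer (a + m%:R) n.
Proof.
elim: n => [|n IH]; first by rewrite addn0 pochhammer0 mulr1.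
by rewrite addnS !pochhammerS IH natrD; ring.
Qed.

Lemma pochhammerSl a n : pochhammer a n.+1 = a * pochhammer (a + 1) n.
Proof. by rewrite -add1n pochhammerD pochhammerS pochhammer0 mul1r addr0. Qed.

Lemma pochhammer_ge0 a n : 0 <= a -> 0 <= pochhammer a n.
Proof.
by move=> a0; elim: n => [|n IH];
  rewrite ?pochhammer0 // pochhammerS mulr_ge0 // addr_ge0.
Qed.

Lemma pochhammer_gt0 a n : 0 < a -> 0 < pochhammer a n.
Proof.
by move=> a0; elim: n => [|n IH];
  rewrite ?pochhammer0 // pochhammerS mulr_gt0 // ltr_wpDr.
Qed.

Lemma pochhammer_neq0 a n : 0 < a -> pochhammer a n != 0.
Proof. by move=> /(@pochhammer_gt0 _ n) /lt0r_neq0. Qed.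

Lemma ler_pochhammer a b n : 0 <= a -> a <= b -> pochhammer a n <= pochhammer b n.
Proof.
move=> a0 ab; elim: n => [|n IH]; first by rewrite !pochhammer0.
by rewrite !pochhammerS ler_pM ?pochhammer_ge0 ?addr_ge0 ?lerD2r.
Qed.

(** Factors of even and odd index are separated. This turns (a)_2k into the upper parameters a/2 and
    (a + 1)/2 of a Gauss series, and with a = 1 it factors (2k)!. *)
Lemma pochhammer_double a n :
  pochhammer a n.*2 = 4 ^+ n * pochhammer (a / 2) n * pochhammer ((a + 1) / 2) n.
Proof.
elim: n => [|n IH]; first by rewrite !pochhammer0 !mulr1.
rewrite doubleS !pochhammerS IH exprS -addn1 natrD -muln2 natrM.
by field.
Qed.

Lemma pochhammer1 n : pochhammer (1 : R) n = n`!%:R.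
Proof.
elim: n => [|n IH]; first by rewrite pochhammer0.
by rewrite pochhammerS IH factS natrM mulrC -natr1 addrC.
Qed.

Lemma fact_pochhammer (k n : nat) :
  (0 < k)%N -> (k + n).-1`!%:R = (k.-1)`!%:R * pochhammer (k%:R : R) n.
Proof.
case: k => // k _; elim: n => [|n IH]; first by rewrite addn0 pochhammer0 mulr1.
rewrite addnS pochhammerS mulrA -IH /= addSn /= factS natrM mulrC.
by rewrite -natr1 -(addn1 k) !natrD; congr (_ * _); ring.
Qed.

End Pochhammer.

(** * Sums over indices of fixed parity *)

Section EvenSums.
Variable V : nmodType.

(** Two enumerations of N, N - 2, ...: by degree, which suits polynomial coefficients and the
    diagonals of a double array, and by the number k of steps down, which is how Gegenbauer sums are
    written. *)
Lemma sum_even_gap (N : nat) (F : nat -> V) :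
  \sum_(0 <= j < N.+1 | ~~ odd (N - j)) F j =
  \sum_(0 <= k < N./2.+1) F (N - k.*2)%N.
Proof.
elim/ltn_ind: N F => -[|[|N]] IH F.
- by rewrite big_mkcond !big_nat1.
- by rewrite big_mkcond big_nat_recr //= !big_nat1 /= add0r.
rewrite big_mkcond big_nat_recr // big_nat_recr //= subnn subSnn /= addr0.
rewrite [RHS]big_nat_recl // addrC subn0; congr (_ + _).
rewrite -big_mkcond; under [RHS]eq_bigr => k _ do rewrite doubleS !subSS.
rewrite -(IH N) //.
rewrite big_nat_cond [RHS]big_nat_cond; apply: eq_bigl => j.
case: leqP => //= jN; rewrite ltnS in jN; by rewrite !subSn ?leqW //= negbK.
Qed.

End EvenSums.

(** * Gegenbauer polynomials and their differential equation *)

Section GegenbauerPolynomials.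
Context {R : realType}.
Implicit Types (mu x y : R) (p q : {poly R}) (n N : nat).

(** The k-th term of [gegenbauer] has degree j = n - 2 k; indexing by j makes the differential
    equation a recurrence between the coefficients of X^j and X^(j+2). *)
Definition gegenbauer_coef mu n j : R :=
  if (j <= n)%N && ~~ odd (n - j) then
    (-1) ^+ (n - j)./2 * pochhammer mu (n - (n - j)./2)
    / ((n - j)./2`!%:R * j`!%:R) * 2 ^+ j
  else 0.

Definition gegenbauer_poly mu n : {poly R} :=
  \poly_(j < n.+1) gegenbauer_coef mu n j.

Lemma coef_gegenbauer_poly mu n j :
  (gegenbauer_poly mu n)`_j = gegenbauer_coef mu n j.
Proof.
by rewrite coef_poly ltnS /gegenbauer_coef; case: leqP.
Qed.

Lemma horner_gegenbauer_poly mu n x :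
  (gegenbauer_poly mu n).[x] = gegenbauer n mu x.
Proof.
rewrite horner_poly /gegenbauer.
pose F j : R := (-1) ^+ (n - j)./2 * pochhammer mu (n - (n - j)./2)
    / ((n - j)./2`!%:R * j`!%:R) * 2 ^+ j * x ^+ j.
transitivity (\sum_(0 <= j < n.+1 | ~~ odd (n - j)) F j).
  rewrite big_mkord [RHS]big_mkcond; apply: eq_bigr => -[j /= jn] _.
  by rewrite /gegenbauer_coef -ltnS jn /= /F; case: ifP => // _; rewrite mul0r.
rewrite sum_even_gap; apply: eq_big_nat => k /andP[_].
rewrite ltnS => kn; have {}kn : (k.*2 <= n)%N by lia.
by rewrite /F subKn // doubleK -[x *+ 2]mulr_natl exprMn mulrA.
Qed.

Lemma gegenbauer_coef_rec mu n j :
  gegenbauer_coef mu n j.+2 * (j.+2 * j.+1)%:R =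
  - (n%:R - j%:R) * (n%:R + j%:R + 2 * mu) * gegenbauer_coef mu n j.
Proof.
(* Beyond the top degree the left side is 0; on the right the factor n - j vanishes if j = n, and
   the coefficient itself by parity if j = n - 1. *)
rewrite /gegenbauer_coef; case: (leqP j.+2 n) => jn /=; last first.
  rewrite mul0r; case: (leqP j n) => /= jn'; last by rewrite mulr0.
  have [->|->] : j = n \/ n = j.+1 by lia.
    by rewrite subrr oppr0 !mul0r.
  by rewrite subSnn /= mulr0.
rewrite (ltnW (ltnW jn)) /=.
have -> : (n - j = (n - j.+2).+2)%N by lia.
rewrite /= negbK; case: ifP => [ev|_]; last by rewrite mul0r mulr0.
set k := (n - j.+2)./2.
have nE : n = (k.*2 + j.+2)%N by rewrite /k; lia.
have -> : (n - k = (n - k.+1).+1)%N by lia.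
rewrite pochhammerS exprS !factS !natrM.
have -> : (n - k.+1)%:R = k.+1%:R + j%:R :> R by rewrite -natrD; congr _%:R; lia.
have -> : n%:R = 2 * k.+1%:R + j%:R :> R.
  by rewrite -natrM -natrD; congr _%:R; lia.
have f0 m : m`!%:R != 0 :> R by rewrite pnatr_eq0 -lt0n fact_gt0.
have s0 m : m.+1%:R != 0 :> R by rewrite pnatr_eq0.
move: (f0 j) (f0 k) (s0 j) (s0 j.+1) (s0 k); rewrite !exprS.
move: (j`!%:R : R) (k`!%:R : R) (j.+1%:R : R) (j.+2%:R : R) (k.+1%:R : R).
move: (j%:R : R) (pochhammer _ _) ((-1) ^+ k) (2 ^+ j : R).
by move=> A B C D E F G H I *; field; do ?[apply/andP; split].
Qed.

Lemma deriv_gegenbauer_poly mu n :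
  (gegenbauer_poly mu n.+1)^`() = (2 * mu) *: gegenbauer_poly (mu + 1) n.
Proof.
apply/polyP => j; rewrite coef_deriv coefZ !coef_gegenbauer_poly.
rewrite /gegenbauer_coef ltnS subSS; case: ifP => [/andP[jn ev]|_]; last first.
  by rewrite mul0rn mulr0.
have -> : (n.+1 - (n - j)./2 = (n - (n - j)./2).+1)%N by lia.
rewrite pochhammerSl factS natrM exprS.
have f0 m : m`!%:R != 0 :> R by rewrite pnatr_eq0 -lt0n fact_gt0.
have s0 m : m.+1%:R != 0 :> R by rewrite pnatr_eq0.
rewrite -[LHS]mulr_natr; move: (f0 j) (f0 (n - j)./2) (s0 j).
move: (j`!%:R : R) ((n - j)./2`!%:R : R) (j.+1%:R : R) (pochhammer _ _).
by move: ((-1) ^+ _) (2 ^+ j : R) => A B C D E F *; field; do ?[apply/andP; split].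
Qed.

(** C_n^mu is an eigenvector of this operator for the eigenvalue - n (n + 2 mu), so that
    [gegenbauer_eqn] at N annihilates C_N^mu. *)
Definition gegenbauer_op mu p : {poly R} :=
  (1 - 'X^2) * p^`()^`() - (2 * mu + 1)%:P * 'X * p^`().

Definition gegenbauer_eqn mu N p : {poly R} :=
  gegenbauer_op mu p + (N%:R * (N%:R + 2 * mu))%:P * p.

Lemma gegenbauer_eqnB mu N p q :
  gegenbauer_eqn mu N (p - q) = gegenbauer_eqn mu N p - gegenbauer_eqn mu N q.
Proof. by rewrite /gegenbauer_eqn /gegenbauer_op !derivB; ring. Qed.

Lemma gegenbauer_eqnZ mu N a p :
  gegenbauer_eqn mu N (a *: p) = a *: gegenbauer_eqn mu N p.
Proof. by rewrite /gegenbauer_eqn /gegenbauer_op !derivZ -!mul_polyC; ring. Qed.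

Lemma gegenbauer_eqn_sum mu N (r : seq nat) (F : nat -> {poly R}) :
  gegenbauer_eqn mu N (\sum_(k <- r) F k) =
  \sum_(k <- r) gegenbauer_eqn mu N (F k).
Proof.
elim: r => [|k r IH]; last first.
  rewrite !big_cons -IH -[X in F k + X]opprK gegenbauer_eqnB.
  by rewrite -[X in _ - gegenbauer_eqn _ _ X]scaleN1r gegenbauer_eqnZ scaleN1r opprK.
by rewrite !big_nil /gegenbauer_eqn /gegenbauer_op !derivC !mulr0 subr0 addr0.
Qed.

(** Apart from the shift by two coming from p'', the operator multiplies X^j by - j (j + 2 mu), and
    N (N + 2 mu) - j (j + 2 mu) = (N - j) (N + j + 2 mu). *)
Lemma coef_gegenbauer_eqn mu N p j :
  (gegenbauer_eqn mu N p)`_j =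
  (j.+2 * j.+1)%:R * p`_j.+2
  + (N%:R - j%:R) * (N%:R + j%:R + 2 * mu) * p`_j.
Proof.
have -> : gegenbauer_eqn mu N p = p^`()^`() - 'X * ('X * p^`()^`())
    - (2 * mu + 1)%:P * ('X * p^`()) + (N%:R * (N%:R + 2 * mu))%:P * p.
  by rewrite /gegenbauer_eqn /gegenbauer_op mulrBl mul1r expr2 !mulrA.
have d1 q i : q^`()`_i = i.+1%:R * q`_i.+1 by rewrite coef_deriv mulr_natl.
rewrite !coefD !coefN !coefCM !coefXM !d1 natrM.
case: j => [|[|j]] /=; rewrite ?coefXM ?d1 /=.
- by move: p`_0 p`_2 (N%:R : R) => *; ring.
- by move: p`_1 p`_3 (N%:R : R) => *; ring.
have -> : j.+2%:R = j%:R + 2 :> R by rewrite -natrD addn2.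
have -> : j.+1%:R = j%:R + 1 :> R by rewrite natr1.
by move: p`_j.+2 p`_j.+4 (N%:R : R) (j.+4%:R : R) (j.+3%:R : R) (j%:R : R) => *; ring.
Qed.

Lemma gegenbauer_poly_eqn mu n N :
  gegenbauer_eqn mu N (gegenbauer_poly mu n) =
  ((N%:R - n%:R) * (N%:R + n%:R + 2 * mu)) *: gegenbauer_poly mu n.
Proof.
apply/polyP => j; rewrite coef_gegenbauer_eqn coefZ !coef_gegenbauer_poly.
rewrite mulrC gegenbauer_coef_rec.
by move: (gegenbauer_coef _ _ _) (N%:R : R) (n%:R : R) (j%:R : R) => *; ring.
Qed.

(* At the singular point 1 the equation has the exponents 0 and 1/2 - mu. *)
Lemma gegenbauer_eqn_root1 mu N p :
  0 < mu -> gegenbauer_eqn mu N p = 0 -> p.[1] = 0 -> p = 0.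
Proof.
move=> mu0 eqn p1; apply/eqP/negPn/negP => p0.
have [m [q]] := multiplicity_XsubC p 1; rewrite p0 /= => q1 pE.
case: m pE => [|m] pE.
  by move: p1 q1; rewrite pE expr0 mulr1 /root => ->; rewrite eqxx.
pose T : {poly R} := 'X - 1%:P.
have T' : T^`() = 1 by rewrite derivXsubC.
pose u := m.+1%:R%:P * q + T * q^`().
have u' : u^`() = m.+1%:R%:P * q^`() + (q^`() + T * q^`()^`()).
  by rewrite derivD mul_polyC derivZ mul_polyC derivM T' mul1r.
have Tn (n : nat) : T * (T ^+ n)^`() = n%:R%:P * T ^+ n.
  rewrite deriv_exp T' mul1r -mulr_natl polyC_natr.
  by case: n => [|n]; rewrite ?mul0r ?mulr0 // mulrCA -exprS.
have p' : p^`() = T ^+ m * u.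
  rewrite pE derivM deriv_exp -/T T' mul1r /u -mulr_natl polyC_natr exprS /=.
  by ring.
have p'' : T * p^`()^`() = T ^+ m * (m%:R%:P * u + T * u^`()).
  by rewrite p' derivM mulrDr !mulrA Tn; ring.
have XE : 'X = T + 1 by rewrite /T subrK.
(* With p = q T^(m+1), this is the equation divided by T^m. Its value at 1 is - (m + 1) (2 m + 2 mu
   + 1) q(1), so q(1) would have to vanish. *)
pose g : {poly R} := - ('X + 1) * (m%:R%:P * u + T * u^`())
  - (2 * mu + 1)%:P * 'X * u + (N%:R * (N%:R + 2 * mu))%:P * T * q.
have gE : T ^+ m * g = 0.
  rewrite -eqn /gegenbauer_eqn /gegenbauer_op.
  have -> : 1 - 'X^2 = - ('X + 1) * T :> {poly R} by rewrite XE; ring.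
  rewrite -[_ * T * _]mulrA p'' p' pE exprS -/T /g.
  by move: (T ^+ m) => Tm; ring.
move/eqP: gE; rewrite mulf_eq0 expf_eq0 polyXsubC_eq0 andbF /= => /eqP gE.
have : g.[1] = 0 by rewrite gE horner0.
rewrite /g u' /u /T !hornerE /= subrr !(mul0r, mulr0, addr0) => /eqP.
have -> : - (1 + 1) * (m%:R * (m.+1%:R * q.[1]))
   - (2 * mu + 1) * (m.+1%:R * q.[1]) =
   - (m.+1%:R * (2 * m%:R + 2 * mu + 1)) * q.[1] by ring.
rewrite mulf_eq0 oppr_eq0 mulf_eq0 pnatr_eq0 /= => /orP[/eqP h|].
  by have := ler0n R m; lra.
by move=> q10; move: q1; rewrite /root q10.
Qed.

(** In the equation the leading coefficient, of degree n < N, is multiplied by (N - n) (N + n + 2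
    mu), which is not 0. *)
Lemma gegenbauer_eqn_size mu N p :
  0 < mu -> gegenbauer_eqn mu N p = 0 -> (size p <= N)%N -> p = 0.
Proof.
move=> mu0 eqn pN; apply/eqP/negPn/negP => p0.
have sp : (0 < size p)%N by rewrite size_poly_gt0.
have := coef_gegenbauer_eqn mu N p (size p).-1; rewrite eqn coef0.
have -> : p`_(size p).-1.+2 = 0 by rewrite (prednK sp) nth_default.
rewrite mulr0 add0r => /esym/eqP; rewrite !mulf_eq0 -/(lead_coef p) lead_coef_eq0.
rewrite (negPf p0) orbF => /orP[|].
  by rewrite subr_eq0 eqr_nat => /eqP ?; lia.
by apply/negP; rewrite lt0r_neq0 // ltr_wpDl ?addr_ge0 ?mulr_gt0.
Qed.

(** At 1 the second derivative drops out of the equation, which leaves (2 mu + 1) C_(n+1)'(1) = (n +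
    1) (n + 1 + 2 mu) C_(n+1)(1). The derivative is 2 mu C_n^(mu+1), so the induction runs over all
    mu at once. *)
Lemma gegenbauer1 mu n : 0 < mu ->
  gegenbauer n mu 1 = pochhammer (2 * mu) n / n`!%:R.
Proof.
elim: n mu => [|n IH] mu mu0.
  by rewrite /gegenbauer big_nat1 /= !pochhammer0 expr0 !mulr1 !mul1r.
have := gegenbauer_poly_eqn mu n.+1 n.+1.
rewrite subrr mul0r scale0r => /(congr1 (horner^~ 1)).
rewrite horner0 /gegenbauer_eqn /gegenbauer_op deriv_gegenbauer_poly.
rewrite !hornerE !horner_gegenbauer_poly IH ?addr_gt0 // expr1n subrr mul0r.
have -> : 2 * (mu + 1) = 2 * mu + 1 + 1 by ring.
move=> E; rewrite factS natrM.
have f0 : n`!%:R != 0 :> R by rewrite pnatr_eq0 -lt0n fact_gt0.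
have n0 : n.+1%:R != 0 :> R by rewrite pnatr_eq0.
have s0 : n.+1%:R + 2 * mu != 0 by rewrite lt0r_neq0 // addr_gt0 ?mulr_gt0.
apply: (mulfI (mulf_neq0 n0 s0)).
have P2 : 2 * mu * (2 * mu + 1) * pochhammer (2 * mu + 1 + 1) n =
    pochhammer (2 * mu) n.+1 * (n.+1%:R + 2 * mu).
  by rewrite [in RHS]addrC -pochhammerS !pochhammerSl; ring.
move: E P2 f0 n0; move: (gegenbauer _ _ _) (pochhammer _ n.+1) (pochhammer _ n).
move: (n.+1%:R : R) (n`!%:R : R) => K F G Q Q' E P2 f0 n0.
have -> : K * (K + 2 * mu) * (Q / (K * F)) = Q * (K + 2 * mu) / F.
  by field; rewrite f0.
rewrite -P2; apply/eqP; rewrite -subr_eq0 -[X in _ == X]E /=; apply/eqP.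
by ring.
Qed.


(* All of X^N / N!, gegenbauer_avg and gegenbauer_sum below obey this recurrence;
   such a family is determined by its values at 1, or by its coefficients of X^N. *)
Definition gegenbauer_rec mu (F : nat -> {poly R}) :=
  (forall N, gegenbauer_eqn mu N.+2 (F N.+2) = F N) /\
  (forall N, (N < 2)%N -> gegenbauer_eqn mu N (F N) = 0).

Lemma gegenbauer_rec_eq mu F G : gegenbauer_rec mu F -> gegenbauer_rec mu G ->
  (forall N, gegenbauer_eqn mu N (F N - G N) = 0 -> F N - G N = 0) -> F =1 G.
Proof.
move=> [FS F0] [GS G0] uniq; elim/ltn_ind => N IH; apply/eqP; rewrite -subr_eq0.
apply/eqP/uniq; rewrite gegenbauer_eqnB.
case: N IH => [|[|N]] IH; last by rewrite FS GS IH ?subrr.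
  by rewrite F0 ?G0 ?subrr.
by rewrite F0 ?G0 ?subrr.
Qed.

(** At N = i + 2 k, the degree of the argument, the multiples of the argument cancel and only terms
    of the same shape and of degree N - 2 remain; this closes the recurrence of [gegenbauer_avg].
    Wherever a natural subtraction is truncated, its coefficient is 0. *)
Lemma gegenbauer_eqn_monomial mu k i :
  gegenbauer_eqn mu (i + k.*2) ((1 - 'X^2) ^+ k * 'X^i) =
  (4 * k%:R * (mu + 2^-1 + k.-1%:R))%:P * ((1 - 'X^2) ^+ k.-1 * 'X^i)
  + (i%:R * i.-1%:R)%:P * ((1 - 'X^2) ^+ k * 'X^(i - 2)).
Proof.
pose w : {poly R} := 1 - 'X^2.
have w' : w^`() = - (2 * 'X).
  by rewrite /w derivB derivC derivXn /= expr1 sub0r mulr_natl.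
have dw n : (w ^+ n)^`() = n%:R%:P * (- (2 * 'X) * w ^+ n.-1).
  by rewrite deriv_exp w' polyC_natr -[LHS]mulr_natl.
have dx n : deriv ('X^n : {poly R}) = n%:R%:P * 'X^(n.-1) :> {poly R}.
  by rewrite derivXn polyC_natr mulr_natl.
have h : (mu + 2^-1)%:P * 2 = mu%:P * 2 + 1 :> {poly R}.
  by rewrite -(polyC_natr _ 2) -!polyCM -polyCD mulrDl mulVf.
rewrite -/w /gegenbauer_eqn /gegenbauer_op.
rewrite !(derivM, derivD, dw, dx, derivC, derivN, derivX).
rewrite natrD -muln2 natrM -!/w.
have -> : (4 * k%:R * (mu + 2^-1 + k.-1%:R))%:P =
  2 * k%:R%:P * (mu%:P * 2 + 1 + 2 * k.-1%:R%:P) :> {poly R}.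
  by rewrite -h -!(polyC_natr _ 2) -!(polyCM, polyCD); congr _%:P; ring.
rewrite !(polyCM, polyCD) !polyC_natr polyC1 {h dw dx w'}.
case: i => [|[|i]]; case: k => [|[|k]]; rewrite ?subSS ?subn0 ?sub0n /= ?exprS ?expr0.
all: first [move: (w ^+ k) ('X^i : {poly R}) | move: (w ^+ k)
  | move: ('X^i : {poly R}) | idtac].
all: by move=> *; rewrite /w ?expr2; ring.
Qed.

(* 1 / N! times the mean of (x y + u sqrt((1 - x^2) (1 - y^2)))^N for the
   probability density proportional to (1 - u^2)^(mu - 1) on [-1, 1]. *)
Definition gegenbauer_avg mu y N : {poly R} :=
  \sum_(0 <= k < N./2.+1)
    (y ^+ (N - k.*2) * (1 - y ^+ 2) ^+ k
     / (4 ^+ k * k`!%:R * (N - k.*2)`!%:R * pochhammer (mu + 2^-1) k))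
    *: ((1 - 'X^2) ^+ k * 'X^(N - k.*2)).

Lemma gegenbauer_avg_rec mu y : 0 < mu -> gegenbauer_rec mu (gegenbauer_avg mu y).
Proof.
move=> mu0.
have f0 n : n`!%:R != 0 :> R by rewrite pnatr_eq0 -lt0n fact_gt0.
have E N k : (k < N./2.+1)%N ->
  gegenbauer_eqn mu N ((1 - 'X^2) ^+ k * 'X^(N - k.*2)) =
  (4 * k%:R * (mu + 2^-1 + k.-1%:R))%:P * ((1 - 'X^2) ^+ k.-1 * 'X^(N - k.*2))
  + ((N - k.*2)%:R * (N - k.*2).-1%:R)%:P * ((1 - 'X^2) ^+ k * 'X^(N - k.*2 - 2)).
  by move=> kN; rewrite -gegenbauer_eqn_monomial subnK //; lia.
split=> [N|N N2]; last first.
  rewrite /gegenbauer_avg gegenbauer_eqn_sum big1_seq // => k.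
  rewrite mem_index_iota => /andP[_ kN].
  rewrite gegenbauer_eqnZ E //.
  have -> : k = 0 by lia.
  rewrite double0 subn0 mulr0 mul0r.
  by case: N N2 {E kN} => [|[|]] // _;
    rewrite /= ?mulr0 ?mul0r ?polyC0 ?mul0r ?addr0 scaler0.
rewrite /gegenbauer_avg gegenbauer_eqn_sum.
rewrite (eq_big_nat _ _ (F2 := fun k =>
  (y ^+ (N.+2 - k.*2) * (1 - y ^+ 2) ^+ k
     / (4 ^+ k * k`!%:R * (N.+2 - k.*2)`!%:R * pochhammer (mu + 2^-1) k)
     * (4 * k%:R * (mu + 2^-1 + k.-1%:R)))
    *: ((1 - 'X^2) ^+ k.-1 * 'X^(N.+2 - k.*2))
  + (y ^+ (N.+2 - k.*2) * (1 - y ^+ 2) ^+ k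
     / (4 ^+ k * k`!%:R * (N.+2 - k.*2)`!%:R * pochhammer (mu + 2^-1) k)
     * ((N.+2 - k.*2)%:R * (N.+2 - k.*2).-1%:R))
    *: ((1 - 'X^2) ^+ k * 'X^(N.+2 - k.*2 - 2)))); last first.
  by move=> k /andP[_ kN]; rewrite gegenbauer_eqnZ E // scalerDr !mul_polyC !scalerA.
(* The first family loses its term k = 0, and the second its last term, whose exponent N + 2 - 2 k
   is below 2. With the first shifted by one, both run over the terms of the average at N. *)
rewrite big_split /= big_nat_recl //= !(mulr0, mul0r, scale0r) add0r.
rewrite [X in _ + X]big_nat_recr //=.
have -> : (N.+2 - N./2.+1.*2)%:R * (N.+2 - N./2.+1.*2).-1%:R = 0 :> R.
  have : (N.+2 - N./2.+1.*2 < 2)%N by lia.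
  by case: (N.+2 - _)%N => [|[|]] // _; rewrite ?mulr0 ?mul0r.
rewrite mulr0 scale0r addr0 -big_split /=; apply: eq_big_nat => k /andP[_ kN].
have -> : (N.+2 - k.*2 = (N - k.*2).+2)%N by lia.
rewrite doubleS !subSS subn0 -scalerDl; congr (_ *: _).
have p0 n : pochhammer (mu + 2^-1) n != 0.
  by rewrite pochhammer_neq0 // addr_gt0 ?invr_gt0.
have s0 : mu + 2^-1 + k%:R != 0.
  by rewrite lt0r_neq0 // ltr_wpDr // addr_gt0 ?invr_gt0.
rewrite pochhammerS !factS !natrM !exprS.
have [n0 n1 n2] : [/\ k.+1%:R != 0 :> R, (N - k.*2).+1%:R != 0 :> R
   & (N - k.*2).+2%:R != 0 :> R] by rewrite !pnatr_eq0.
have q0 : 4 ^+ k != 0 :> R by rewrite expf_neq0.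
move: (f0 k) (f0 (N - k.*2)%N) (p0 k) s0 n0 n1 n2 q0.
move: (k`!%:R : R) ((N - k.*2)`!%:R : R) (pochhammer _ _) (mu + _ + _).
move: (k.+1%:R : R) ((N - k.*2).+1%:R : R) ((N - k.*2).+2%:R : R) (4 ^+ k : R).
move: (y ^+ (N - k.*2)) ((1 - y * (y * y ^+ 0)) ^+ k).
rewrite expr0 mulr1 => A B C D F G H I J K *.
by field; do ?[apply/andP; split].
Qed.

(** The denominators are forced by the recurrence: with n = N - 2 k, the equation at N multiplies
    C_n^mu by 4 k (mu + n + k), the ratio of the denominators for k and k - 1. The coefficients h n
    stay free. *)
Definition gegenbauer_sum mu (h : nat -> R) N : {poly R} :=
  \sum_(0 <= k < N./2.+1)
    (h (N - k.*2)%N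
     / (4 ^+ k * k`!%:R * pochhammer (mu + (N - k.*2)%:R + 1) k))
    *: gegenbauer_poly mu (N - k.*2).

Lemma gegenbauer_sum_rec mu h : 0 < mu -> gegenbauer_rec mu (gegenbauer_sum mu h).
Proof.
move=> mu0.
have f0 n : n`!%:R != 0 :> R by rewrite pnatr_eq0 -lt0n fact_gt0.
have E N k : (k < N./2.+1)%N ->
  gegenbauer_eqn mu N (gegenbauer_poly mu (N - k.*2)) =
  (4 * k%:R * (mu + (N - k.*2)%:R + k%:R)) *: gegenbauer_poly mu (N - k.*2).
  move=> kN; rewrite gegenbauer_poly_eqn; congr (_ *: _).
  have -> : N%:R = (N - k.*2)%:R + 2 * k%:R :> R.
    by rewrite -natrM -natrD mul2n subnK //; lia.
  by move: ((N - k.*2)%:R : R) (k%:R : R) => *; ring.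
split=> [N|N N2]; last first.
  rewrite /gegenbauer_sum gegenbauer_eqn_sum big1_seq // => k.
  rewrite mem_index_iota => /andP[_ kN].
  rewrite gegenbauer_eqnZ E //.
  have -> : k = 0 by lia.
  by rewrite mulr0 mul0r scale0r scaler0.
rewrite /gegenbauer_sum gegenbauer_eqn_sum.
rewrite (eq_big_nat _ _ (F2 := fun k =>
  (h (N.+2 - k.*2)%N
     / (4 ^+ k * k`!%:R * pochhammer (mu + (N.+2 - k.*2)%:R + 1) k)
   * (4 * k%:R * (mu + (N.+2 - k.*2)%:R + k%:R)))
    *: gegenbauer_poly mu (N.+2 - k.*2))); last first.
  by move=> k /andP[_ kN]; rewrite gegenbauer_eqnZ E // scalerA.
rewrite big_nat_recl //= !(mulr0, mul0r, scale0r) add0r.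
apply: eq_big_nat => k /andP[_ kN]; rewrite doubleS !subSS; congr (_ *: _).
rewrite pochhammerS factS natrM exprS -natr1.
set c := mu + _.
have c0 : 0 < c by rewrite ltr_wpDr.
have p0 : pochhammer (c + 1) k != 0 by rewrite pochhammer_neq0 // addr_gt0.
have s0 : c + 1 + k%:R != 0 by rewrite lt0r_neq0 // ltr_wpDr // addr_gt0.
have n0 : k%:R + 1 != 0 :> R by rewrite natr1 pnatr_eq0.
have q0 : 4 ^+ k != 0 :> R by rewrite expf_neq0.
move: (f0 k) p0 s0 n0 q0; move: (k`!%:R : R) (pochhammer _ _) (4 ^+ k : R) => *.
by field; do ?[apply/andP; split].
Qed.

Lemma gegenbauer_avg1 mu N :
  gegenbauer_avg mu 1 N = (N`!%:R)^-1 *: 'X^N.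
Proof.
rewrite /gegenbauer_avg big_nat_recl // big1_seq => [|k _].
  by rewrite double0 subn0 !expr0 expr1n pochhammer0 fact0 !mulr1 !mul1r addr0.
by rewrite [X in 1 - X]expr1n subrr expr0n /= mulr0 mul0r scale0r.
Qed.

(** The right side is the average at y = 1, and the coefficients of X^N decide: only the term k = 0
    reaches degree N, and h reduces the leading coefficient 2^N (mu)_N / N! of C_N^mu to 1 / N!. *)
Lemma monomial_gegenbauer_sum mu N : 0 < mu ->
  gegenbauer_sum mu (fun n => (2 ^+ n * pochhammer mu n)^-1) N =
  (N`!%:R)^-1 *: 'X^N.
Proof.
move=> mu0; rewrite -(gegenbauer_avg1 mu).
apply: gegenbauer_rec_eq N; [exact: gegenbauer_sum_rec|exact: gegenbauer_avg_rec|].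
move=> N eqn; apply: (gegenbauer_eqn_size mu0 eqn).
apply/leq_sizeP => j Nj; rewrite gegenbauer_avg1 /gegenbauer_sum.
rewrite big_nat_recl // !(coefB, coefD, coefZ, coef_sum) big1_seq => [|k]; last first.
  rewrite mem_index_iota => /andP[_ kN]; rewrite coefZ coef_gegenbauer_poly.
  by rewrite /gegenbauer_coef leqNgt (_ : (N - k.+1.*2 < j)%N) ?mulr0 //=; lia.
rewrite double0 subn0 addr0 coefN coefZ coefXn coef_gegenbauer_poly /gegenbauer_coef.
move: Nj; rewrite leq_eqVlt => /orP[/eqP <-|Nj]; last first.
  by rewrite leqNgt Nj (gtn_eqF Nj) !mulr0 subrr.
rewrite leqnn subnn eqxx /= !expr0 subn0 pochhammer0.
have f0 : N`!%:R != 0 :> R by rewrite pnatr_eq0 -lt0n fact_gt0.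
have p0 : pochhammer mu N != 0 by rewrite pochhammer_neq0.
have q0 : 2 ^+ N != 0 :> R by rewrite expf_neq0.
rewrite fact0; move: f0 p0 q0.
move: (N`!%:R : R) (pochhammer _ _) (2 ^+ N : R) => A B C *.
by field; do ?[apply/andP; split].
Qed.

(** Here the values at 1 decide: the average is y^N / N!, and C_n^mu(1) = (2 mu)_n / n! cancels part
    of the coefficient, leaving [monomial_gegenbauer_sum] evaluated at y. *)
Lemma gegenbauer_avgE mu y N : 0 < mu ->
  gegenbauer_avg mu y N =
  gegenbauer_sum mu (fun n => n`!%:R / (2 ^+ n * pochhammer mu n *
    pochhammer (2 * mu) n) * gegenbauer n mu y) N.
Proof.
move=> mu0.
apply: gegenbauer_rec_eq N; [exact: gegenbauer_avg_rec|exact: gegenbauer_sum_rec|].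
move=> N eqn; apply: (gegenbauer_eqn_root1 mu0 eqn).
rewrite hornerD hornerN; apply/eqP; rewrite subr_eq0; apply/eqP.
transitivity (N`!%:R^-1 * y ^+ N).
  rewrite /gegenbauer_avg horner_sum big_nat_recl // big1_seq => [|k _].
    rewrite double0 subn0 !expr0 !mul1r mulr1 hornerZ hornerXn expr1n mulr1 addr0.
    by rewrite pochhammer0 !mulr1 mulrC.
  rewrite hornerZ hornerM horner_exp hornerD hornerN hornerXn hornerC expr1n.
  by rewrite subrr expr0n /= mul0r mulr0.
have -> : N`!%:R^-1 * y ^+ N = ((N`!%:R)^-1 *: 'X^N).[y].
  by rewrite hornerZ hornerXn.
rewrite -(monomial_gegenbauer_sum _ mu0) /gegenbauer_sum !horner_sum.
apply: eq_bigr => k _; rewrite !hornerZ !horner_gegenbauer_poly gegenbauer1 //.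
set n := (N - _)%N.
have f0 : n`!%:R != 0 :> R by rewrite pnatr_eq0 -lt0n fact_gt0.
have p0 : pochhammer (2 * mu) n != 0 by rewrite pochhammer_neq0 // mulr_gt0.
move: (2 ^+ n * pochhammer mu n) (4 ^+ k * _ * _) f0 p0 => A B.
rewrite !invfM; move: A^-1 B^-1 (n`!%:R : R) (pochhammer _ _) => A' B' C D *.
by field; do ?[apply/andP; split].
Qed.

End GegenbauerPolynomials.

(** * Series, rearrangement and Cauchy products *)

Section Series.
Context {R : realType}.
Local Open Scope classical_set_scope.
Implicit Types (u v : nat -> R) (t : nat -> nat -> R).

Definition has_sum u (l : R) : Prop := series u @ \oo --> l.

Lemma has_sum_unique u (l l' : R) : has_sum u l -> has_sum u l' -> l = l'.
Proof. by move=> h h'; apply: (cvg_unique _ h h'). Qed.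

Lemma has_sum_lim u (l : R) : has_sum u l -> limn (series u) = l.
Proof. by move=> h; apply: cvg_lim. Qed.

Lemma has_sum_is_cvg u : cvgn (series u) -> has_sum u (limn (series u)).
Proof. by []. Qed.

Lemma eq_has_sum u v (l : R) : u =1 v -> has_sum u l -> has_sum v l.
Proof. by move=> /funext ->. Qed.

Lemma has_sumZ (c : R) u (l : R) : has_sum u l -> has_sum (fun n => c * u n) (c * l).
Proof.
move=> ul; rewrite /has_sum (_ : series _ = (fun n => c * series u n)).
  by apply: cvgMr.
by apply/funext => n; rewrite /series /= mulr_sumr.
Qed.

(** If c = 0, nothing is known about u, but then l = 0 and the value of [limn] is immaterial. In the
    addition theorem c contains Gegenbauer values, which may vanish. *)
Lemma has_sumZ_lim (c : R) u (l : R) :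
  has_sum (fun n => c * u n) l -> l = c * limn (series u).
Proof.
have [-> h|c0 h] := eqVneq c 0.
  rewrite mul0r; apply: has_sum_unique h _.
  rewrite /has_sum (_ : series _ = cst 0); first exact: cvg_cst.
  by apply/funext => n; rewrite /series /= big1 // => i _; rewrite mul0r.
have /has_sum_lim -> : has_sum u (c^-1 * l); last by rewrite mulVKf.
apply: (@eq_has_sum (fun n => c^-1 * (c * u n))) => [n|]; last exact: has_sumZ.
by rewrite mulKf.
Qed.

Lemma has_sum_ge0 u (l : R) : (forall n, 0 <= u n) -> has_sum u l -> 0 <= l.
Proof.
move=> u0 ul; rewrite -(has_sum_lim ul); apply: limr_ge.
  by apply/cvg_ex; exists l.
by apply: nearW => n; rewrite /series /= sumr_ge0.
Qed.

Lemma series_le_has_sum u (l : R) n : (forall n, 0 <= u n) -> has_sum u l ->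
  series u n <= l.
Proof.
move=> u0 ul; rewrite -(has_sum_lim ul); apply: nondecreasing_cvgn_le.
  by apply/nondecreasing_seqP => k; rewrite -subr_ge0 seriesSB.
by apply/cvg_ex; exists l.
Qed.

Lemma is_cvg_series_bounded u (K : R) : (forall n, 0 <= u n) ->
  (forall n, series u n <= K) -> cvgn (series u).
Proof.
move=> u0 uK; apply: nondecreasing_is_cvgn.
  by apply/nondecreasing_seqP => k; rewrite -subr_ge0 seriesSB.
by exists K => _ [n _ <-].
Qed.

Lemma sum_triangle (V : zmodType) (t : nat -> nat -> V) (M I J : nat) :
  (M <= I)%N -> (M <= J)%N ->
  \sum_(0 <= N < M) \sum_(0 <= i < N.+1) t i (N - i)%N =
  \sum_(0 <= i < I) \sum_(0 <= j < J | (i + j < M)%N) t i j.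
Proof.
elim: M => [|M IH] MI MJ.
  by rewrite big_geq // big1 // => i _; rewrite big_pred0 // => j; rewrite ltn0.
rewrite big_nat_recr //= (IH (ltnW MI) (ltnW MJ)).
rewrite [X in _ + X](big_nat_widen _ _ _ _ _ MI) [X in _ + X]big_mkcond /= -big_split /=.
apply: eq_bigr => i _.
rewrite [RHS](bigID (fun j => (i + j < M)%N)) /=; congr (_ + _).
  by apply: eq_bigl => j; lia.
transitivity (\sum_(0 <= j < J | (i + j == M)%N) t i j); last first.
  by apply: eq_bigl => j; rewrite -leqNgt ltnS -eqn_leq.
case: ltnP => iM.
  rewrite (eq_bigl (fun j => j == M - i)%N) => [|j]; last by apply/eqP/eqP; lia.
  by rewrite big_nat1_eq ifT //; lia.
by rewrite big_pred0 // => j; apply/eqP; lia.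
Qed.

(** Polynomial identities give the diagonals, while the rows are what has to be summed; a bound on
    the absolute diagonals controls both. *)
Lemma triangular_fubini t (K : R) :
  (forall M, \sum_(0 <= N < M) \sum_(0 <= i < N.+1) `|t i (N - i)%N| <= K) ->
  exists u (L : R), [/\ forall i, has_sum (t i) (u i), has_sum u L
    & has_sum (fun N => \sum_(0 <= i < N.+1) t i (N - i)%N) L].
Proof.
move=> bnd.
pose A := series (fun N => \sum_(0 <= i < N.+1) `|t i (N - i)%N|).
pose D := series (fun N => \sum_(0 <= i < N.+1) t i (N - i)%N).
have d0 N : 0 <= \sum_(0 <= i < N.+1) `|t i (N - i)%N| by apply: sumr_ge0.
have cA : cvgn A by apply: (is_cvg_series_bounded d0 bnd).
have cD : cvgn D.
  apply: normed_cvg; apply: series_le_cvg cA => //= n; exact: ler_norm_sum.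
have row i : cvgn (series (t i)).
  apply: normed_cvg; apply: (@is_cvg_series_bounded _ K) => //= n.
  apply: le_trans (bnd (i + n)%N).
  (* The first n entries of row i lie in the triangle of size i + n; one more row is allowed so that
     row i exists when n = 0. *)
  rewrite (@sum_triangle _ (fun i j => `|t i j|) (i + n) (i + n).+1 (i + n)) //.
  rewrite (big_cat_nat (n := i)) //=; last lia.
  rewrite ler_wpDl ?sumr_ge0 // => [*|]; first by rewrite sumr_ge0.
  rewrite big_nat_recl ?leq_addr // ler_wpDr ?sumr_ge0 // => [*|].
    by rewrite sumr_ge0.
  rewrite /series /= (big_nat_widen _ _ _ _ _ (leq_addl i n)) /=.
  by under [leRHS]eq_bigl => j do rewrite ltn_add2l.
pose u i := limn (series (t i)).
have hu i : has_sum (t i) (u i) by apply: row.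
(* Uniform in I: for each finite J, what the first I rows contain beyond the triangle of size M lies
   in the triangle of size I + J, so the tail of the absolute series bounds it. *)
have rect I M : (M <= I)%N -> `|\sum_(0 <= i < I) u i - D M| <= limn A - A M.
  move=> MI.
  have cv : (fun J => `|\sum_(0 <= i < I) series (t i) J - D M|) @ \oo -->
      `|\sum_(0 <= i < I) u i - D M|.
    apply: cvg_norm; apply: cvgB; last exact: cvg_cst.
    elim: I {MI} => [|I IH].
      rewrite big_geq // (_ : (fun _ => _) = cst 0); first exact: cvg_cst.
      by apply/funext => J; rewrite big_geq.
    rewrite big_nat_recr //= (_ : (fun _ => _) = (fun J =>
      \sum_(0 <= i < I) series (t i) J + series (t I) J)).
      by apply: cvgD => //; apply: hu.
    by apply/funext => J; rewrite big_nat_recr.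
  rewrite -(cvg_lim _ cv) //; apply: limr_le; first by apply/cvg_ex; eexists; exact: cv.
  near=> J.
  have MJ : (M <= J)%N by near: J; exact: nbhs_infty_ge.
  have -> : \sum_(0 <= i < I) series (t i) J - D M =
      \sum_(0 <= i < I) \sum_(0 <= j < J | (M <= i + j)%N) t i j.
    rewrite /D /series /= (sum_triangle _ MI MJ) -sumrB; apply: eq_bigr => i _.
    rewrite (bigID (fun j => (i + j < M)%N)) /= addrAC subrr add0r.
    by apply: eq_bigl => j; rewrite -leqNgt.
  have AIJ : A (I + J)%N <= limn A.
    apply: nondecreasing_cvgn_le => //.
    by apply/nondecreasing_seqP => k; rewrite -subr_ge0 seriesSB.
  apply: le_trans (_ : A (I + J)%N - A M <= _); last by rewrite lerB.
  rewrite /A /series /=.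
  rewrite (@sum_triangle _ (fun i j => `|t i j|) (I + J) (I + J) (I + J)) //.
  rewrite (@sum_triangle _ (fun i j => `|t i j|) M (I + J) (I + J)); [|lia..].
  rewrite -sumrB [leRHS](big_cat_nat (n := I)) ?leq_addr //=.
  have st i : \sum_(0 <= j < I + J | (i + j < I + J)%N) `|t i j|
    - \sum_(0 <= j < I + J | (i + j < M)%N) `|t i j| =
     \sum_(0 <= j < I + J | (M <= i + j < I + J)%N) `|t i j|.
    rewrite [X in X - _](bigID (fun j => (i + j < M)%N)) /= addrAC.
    rewrite (eq_bigl (fun j => (i + j < M)%N)) => [|j]; last lia.
    by rewrite subrr add0r; apply: eq_bigl => j; lia.
  rewrite ler_wpDr //; first by apply: sumr_ge0 => i _; rewrite st sumr_ge0.
  apply: le_trans (ler_norm_sum _ _ _) _; rewrite ler_sum_nat // => i /andP[_ iI].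
  apply: le_trans (ler_norm_sum _ _ _) _; rewrite st.
  rewrite (big_nat_widen _ _ _ _ _ (leq_addl I J)) [leRHS]big_mkcond /=.
  rewrite big_mkcond ler_sum // => j _.
  by case: ifPn => h1; case: ifPn => h2 //; lia.
exists u, (limn D); split => //.
apply/cvgrPdist_le => e e0.
have e20 : 0 < e / 2 by rewrite divr_gt0.
have [M [hA hD]] : exists M, `|limn A - A M| <= e / 2 /\ `|limn D - D M| <= e / 2.
  have /cvgrPdist_le /(_ _ e20) h1 := cA.
  have /cvgrPdist_le /(_ _ e20) h2 := cD.
  have [M _ /(_ M (leqnn M)) [hA hD]] := filterI h1 h2.
  by exists M.
near=> I.
have MI : (M <= I)%N by near: I; exact: nbhs_infty_ge.
rewrite (splitr e) -(subrKA (D M)); apply: le_trans (ler_normD _ _) _.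
rewrite lerD // distrC; apply: le_trans (rect _ _ MI) _.
exact: le_trans (ler_norm _) hA.
Unshelve. all: by end_near.
Qed.

Lemma cauchy_product u v (U V : R) :
  cvgn (series (fun n => `|u n|)) -> cvgn (series (fun n => `|v n|)) ->
  has_sum u U -> has_sum v V ->
  has_sum (fun N => \sum_(0 <= i < N.+1) u i * v (N - i)%N) (U * V).
Proof.
move=> cu cv hU hV.
have [M|s [L [hs sL dL]]] := @triangular_fubini (fun i j => u i * v j)
    (limn (series (fun n => `|u n|)) * limn (series (fun n => `|v n|))).
  rewrite (@sum_triangle _ (fun i j => `|u i * v j|) M M M) //.
  apply: le_trans (_ : (series (fun n => `|u n|)) M * (series (fun n => `|v n|)) M <= _).
    rewrite /series /= big_distrlr /= ler_sum // => i _.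
    rewrite big_mkcond ler_sum // => j _; by case: ifP => _; rewrite ?normrM // mulr_ge0.
  by apply: ler_pM; rewrite ?sumr_ge0 ?series_le_has_sum.
suff <- : L = U * V by [].
apply: has_sum_unique sL _; rewrite mulrC.
apply: (@eq_has_sum (fun i => V * u i)) => [i|]; last exact: has_sumZ.
rewrite mulrC.
by apply: (@has_sum_unique (fun j => u i * v j)); [exact: has_sumZ|exact: hs].
Qed.

(** The partial sums of v are those of u of even length, a subsequence. *)
Lemma has_sum_even u (v : nat -> R) (l : R) :
  (forall n, u n = if odd n then 0 else v n./2) -> has_sum u l -> has_sum v l.
Proof.
move=> uE ul.
have -> : has_sum v l = ((fun n => series u n.*2) @ \oo --> l).
  rewrite /has_sum; congr (_ @ \oo --> l); apply/funext => n.
  rewrite /series /=; elim: n => [|n IH]; first by rewrite !big_geq.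
  rewrite doubleS !big_nat_recr //= IH !uE /= odd_double /= addr0.
  by rewrite doubleK.
apply: cvg_comp ul => //.
move=> S [N _ NS]; exists N => // n /= Nn; apply: NS => /=.
by apply: leq_trans Nn _; rewrite -addnn leq_addr.
Qed.

End Series.

(** * Binomial and Gauss series, Euler's transformation *)

Section HypergeometricSeries.
Context {R : realType}.
Implicit Types (a b c x : R) (n N : nat).
Local Open Scope classical_set_scope.

(** The coefficient of x^n in (1 - x)^(-a). *)
Definition binomial_coef a n : R := pochhammer a n / n`!%:R.

Lemma binomial_coefS a n :
  binomial_coef a n.+1 * n.+1%:R = binomial_coef a n * (a + n%:R).
Proof.
rewrite /binomial_coef pochhammerS factS natrM.
have : n`!%:R != 0 :> R by rewrite pnatr_eq0 -lt0n fact_gt0.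
have : n.+1%:R != 0 :> R by rewrite pnatr_eq0.
move: (n.+1%:R : R) (n`!%:R : R) (pochhammer a n) => A B C *.
by field; do ?[apply/andP; split].
Qed.

Lemma binomial_coef0 a : binomial_coef a 0 = 1.
Proof. by rewrite /binomial_coef pochhammer0 mul1r fact0 invr1. Qed.

Lemma binomial_coef_ge0 a n : 0 <= a -> 0 <= binomial_coef a n.
Proof. by move=> a0; rewrite divr_ge0 ?pochhammer_ge0. Qed.

Lemma ler_binomial_coef a b n : 0 <= a -> a <= b ->
  binomial_coef a n <= binomial_coef b n.
Proof. by move=> a0 ab; rewrite ler_pM2r ?invr_gt0 ?ltr0n ?fact_gt0 ?ler_pochhammer. Qed.

Lemma vandermonde a b N :
  \sum_(0 <= i < N.+1) binomial_coef a i * binomial_coef b (N - i) =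
  binomial_coef (a + b) N.
Proof.
elim: N => [|N IH]; first by rewrite big_nat1 !binomial_coef0 mulr1.
have n0 : N.+1%:R != 0 :> R by rewrite pnatr_eq0.
apply: (mulIf n0); rewrite binomial_coefS -IH !mulr_suml.
(* Split N + 1 = i + (N + 1 - i): the second part yields the factor b + N - i, the first is
   telescoped by [f] into a + i, and together they make a + b + N. *)
pose f i := i%:R * (binomial_coef a i * binomial_coef b (N.+1 - i)).
rewrite [LHS]big_nat_recr //=.
have -> : binomial_coef a N.+1 * binomial_coef b (N.+1 - N.+1) * N.+1%:R = f N.+1 - f 0.
  by rewrite /f mul0r subr0 mulrC.
rewrite -telescope_sumr // -big_split /=; apply: eq_big_nat => i /andP[_].
rewrite ltnS => iN; rewrite /f subSS (subSn iN).
have E1 := binomial_coefS a i; have := binomial_coefS b (N - i).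
have -> : (N.+1)%:R = i%:R + (N - i).+1%:R :> R by rewrite -natrD addnS subnKC.
have -> : N%:R = i%:R + (N - i)%:R :> R by rewrite -natrD subnKC.
move: (N - i).+1%:R E1 => K; move: (i.+1%:R : R) => J E1 E2.
have -> : J * (binomial_coef a i.+1 * binomial_coef b (N - i)) =
   binomial_coef a i.+1 * J * binomial_coef b (N - i) by ring.
rewrite E1 mulrDr.
have -> : binomial_coef a i * binomial_coef b (N - i).+1 * K =
   binomial_coef a i * (binomial_coef b (N - i).+1 * K) by ring.
rewrite E2; move: (binomial_coef _ _) (binomial_coef _ _) (binomial_coef _ _) => X Y Z.
by move: (i%:R : R) ((N - i)%:R : R) => *; ring.
Qed.

Definition gauss_coef a b c n : R :=
  pochhammer a n * pochhammer b n / (pochhammer c n * n`!%:R).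

Lemma gauss_coefS a b c n : 0 < c ->
  gauss_coef a b c n.+1 * (n.+1%:R * (c + n%:R)) =
  gauss_coef a b c n * ((a + n%:R) * (b + n%:R)).
Proof.
move=> c0; rewrite /gauss_coef !pochhammerS factS natrM.
have : n`!%:R != 0 :> R by rewrite pnatr_eq0 -lt0n fact_gt0.
have : n.+1%:R != 0 :> R by rewrite pnatr_eq0.
have : c + n%:R != 0 by rewrite lt0r_neq0 // ltr_wpDr.
have := pochhammer_neq0 n c0.
move: (n.+1%:R : R) (n`!%:R : R) (pochhammer _ _) (pochhammer _ _) (pochhammer _ _) =>
  A B C D E *.
by field; do ?[apply/andP; split].
Qed.

Lemma gauss_coef0 a b c : gauss_coef a b c 0 = 1.
Proof. by rewrite /gauss_coef !pochhammer0 fact0 !mulr1 ?mul1r ?invr1. Qed.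

(* Multiplying the N-th sum by N (c + N - 1) turns it into the previous one up
   to the telescoping sequence f. *)
Lemma saalschutz a b c N : 0 < c ->
  \sum_(0 <= i < N.+1) gauss_coef a b c i * binomial_coef (c - a - b) (N - i) =
  gauss_coef (c - a) (c - b) c N.
Proof.
move=> c0; elim: N => [|N IH].
  by rewrite big_nat1 !gauss_coef0 binomial_coef0 mulr1.
have n0 : N.+1%:R * (c + N%:R) != 0.
  by rewrite mulf_neq0 ?pnatr_eq0 // lt0r_neq0 // ltr_wpDr.
apply: (mulIf n0); rewrite gauss_coefS // -IH !mulr_suml.
pose f i := i%:R * (c + i%:R - 1) *
  (gauss_coef a b c i * binomial_coef (c - a - b) (N.+1 - i)).
rewrite [LHS]big_nat_recr //=.
have -> : gauss_coef a b c N.+1 * binomial_coef (c - a - b) (N.+1 - N.+1) *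
    (N.+1%:R * (c + N%:R)) = f N.+1 - f 0.
  by rewrite /f !mul0r subr0 -natr1 addrA addrK mulrC.
rewrite -telescope_sumr // -big_split /=; apply: eq_big_nat => i /andP[_].
rewrite ltnS => iN; rewrite /f subSS (subSn iN).
have E1 := gauss_coefS a b i c0; have := binomial_coefS (c - a - b) (N - i).
have -> : c + i.+1%:R - 1 = c + i%:R by rewrite -natr1 addrA addrK.
have -> : (N.+1)%:R = i%:R + (N - i)%:R + 1 :> R by rewrite -natrD subnKC // natr1.
have -> : N%:R = i%:R + (N - i)%:R :> R by rewrite -natrD subnKC.
have -> : (N - i).+1%:R = (N - i)%:R + 1 :> R by rewrite natr1.
move: (N - i)%:R E1 => K; move: (i.+1%:R : R) => J E1 E2.
have -> : J * (c + i%:R) *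
    (gauss_coef a b c i.+1 * binomial_coef (c - a - b) (N - i)) =
   gauss_coef a b c i.+1 * (J * (c + i%:R)) * binomial_coef (c - a - b) (N - i).
  by ring.
rewrite E1.
move: E2; move: (binomial_coef _ _) (binomial_coef _ _) (gauss_coef _ _ _ _).
move: (i%:R : R) => I X Y Z E2.
have -> : Z * Y * ((I + K + 1) * (c + (I + K))) =
  Z * Y * I * (c + I - 1) + Z * (Y * (K + 1)) * (c + 2 * I + K) by ring.
by rewrite E2; ring.
Qed.

Lemma binomial_series_nat N x : `|x| < 1 ->
  has_sum (fun n => binomial_coef N%:R n * x ^+ n) ((1 - x) ^- N).
Proof.
elim: N x => [|N IH] x x1.
  rewrite expr0 invr1 /has_sum; apply: cvg_near_cst; near=> n.
  have n0 : (0 < n)%N by near: n; exact: nbhs_infty_gt.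
  rewrite /series /= -(prednK n0) big_nat_recl // big1 => [|i _].
    by rewrite binomial_coef0 expr0 mulr1 addr0.
  by rewrite /binomial_coef pochhammerSl !mul0r.
have nE : forall y : R, `|y| < 1 -> has_sum (fun n => y ^+ n) (1 - y)^-1.
  move=> y y1; have := @cvg_geometric_series _ 1 y y1; rewrite mul1r.
  by apply: eq_has_sum => n; rewrite /geometric /= mul1r.
have xx : `| `|x| | < 1 by rewrite normr_id.
have := cauchy_product _ _ (IH _ x1) (nE _ x1).
rewrite -invfM -exprSr => h; apply: eq_has_sum (h _ _) => [n||].
- rewrite -[in RHS]natr1 -vandermonde mulr_suml; apply: eq_big_nat => i /andP[_].
  rewrite ltnS => ni; rewrite -mulrA -exprD subnKC //; congr (_ * _).
  rewrite [in RHS]/(binomial_coef 1 _) pochhammer1 divff ?mulr1 //.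
- apply/cvg_ex; exists ((1 - `|x|) ^- N).
  apply: eq_has_sum (IH _ xx) => n.
  by rewrite normrM normrX (ger0_norm (binomial_coef_ge0 _ _)).
- by apply/cvg_ex; exists (1 - `|x|)^-1; apply: eq_has_sum (nE _ xx) => n; rewrite normrX.
Unshelve. all: by end_near.
Qed.

Lemma is_cvg_binomial_series a x : 0 <= a -> 0 <= x < 1 ->
  cvgn (series (fun n => binomial_coef a n * x ^+ n)).
Proof.
move=> a0 /andP[x0 x1]; have [N aN] : exists N : nat, a <= N%:R.
  by exists (Num.truncn a).+1; rewrite ltW // truncnS_gt.
have t0 b n : 0 <= b -> 0 <= binomial_coef b n * x ^+ n.
  by move=> b0; rewrite mulr_ge0 ?binomial_coef_ge0 ?exprn_ge0.
apply: (@series_le_cvg _ _ (fun n => binomial_coef N%:R n * x ^+ n)) => [n|n|n|].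
- exact: t0.
- exact: t0.
- by rewrite ler_wpM2r ?exprn_ge0 // ler_binomial_coef.
- apply/cvg_ex; eexists; apply: binomial_series_nat; by rewrite ger0_norm.
Qed.

(** The Cauchy square of this series is the one of exponent N, and its sum is nonnegative, hence the
    square root. *)
Lemma binomial_series_half N x : 0 <= x < 1 ->
  has_sum (fun n => binomial_coef (N%:R / 2) n * x ^+ n) ((1 - x) `^ (- (N%:R / 2))).
Proof.
move=> x01; have /andP[x0 x1] := x01.
have N0 : 0 <= N%:R / 2 :> R by rewrite divr_ge0.
have t0 n : 0 <= binomial_coef (N%:R / 2) n * x ^+ n.
  by rewrite mulr_ge0 ?binomial_coef_ge0 ?exprn_ge0.
have cv := is_cvg_binomial_series N0 x01.
have hs := has_sum_is_cvg cv; set s := limn _ in hs.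
have s0 : 0 <= s by apply: has_sum_ge0 hs.
have cn : cvgn (series (fun n => `|binomial_coef (N%:R / 2) n * x ^+ n|)).
  by under eq_fun do rewrite ger0_norm //.
have x10 : 0 < 1 - x by rewrite subr_gt0.
have ss : s * s = (1 - x) ^- N.
  apply: has_sum_unique (cauchy_product cn cn hs hs) _.
  have x1' : `|x| < 1 by rewrite ger0_norm.
  apply: eq_has_sum (@binomial_series_nat N _ x1') => n.
  rewrite {1}(splitr N%:R) -vandermonde mulr_suml; apply: eq_big_nat => i /andP[_].
  rewrite ltnS => ni.
  have -> : x ^+ n = x ^+ i * x ^+ (n - i) by rewrite -exprD subnKC.
  by move: (binomial_coef _ _) (binomial_coef _ _) => *; ring.
suff <- : s = (1 - x) `^ (- (N%:R / 2)) by [].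
apply/eqP; rewrite -(@eqrXn2 _ 2) ?powR_ge0 // expr2 ss.
by rewrite -[X in _ == X]powR_mulrn ?powR_ge0 // -powRrM mulNr divfK // powRN powR_mulrn // ltW.
Qed.

(** For b <= c the ratio (b)_n / (c)_n is at most 1, so the binomial series of exponent a
    dominates. *)
Lemma gauss_series_bound a b c x : 0 <= a -> 0 <= b -> b <= c -> 0 < c -> 0 <= x < 1 ->
  cvgn (series (fun n => gauss_coef a b c n * x ^+ n)).
Proof.
move=> a0 b0 bc c0 x01; have /andP[x0 x1] := x01.
apply: series_le_cvg (is_cvg_binomial_series a0 x01) => n.
- by rewrite mulr_ge0 ?exprn_ge0 ?divr_ge0 ?mulr_ge0 ?pochhammer_ge0 // ltW.
- by rewrite mulr_ge0 ?binomial_coef_ge0 ?exprn_ge0.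
- rewrite ler_wpM2r ?exprn_ge0 // /gauss_coef /binomial_coef invfM mulrACA.
  rewrite mulrA ler_wpM2r ?invr_ge0 // -mulrA ler_piMr ?pochhammer_ge0 //.
  rewrite mulrC ler_pdivrMr ?pochhammer_gt0 // mul1r; exact: ler_pochhammer.
Qed.

(** Multiplying the Gauss series by the binomial series of exponent c - a - b produces, coefficient
    by coefficient, the sums of [saalschutz]. For Q the exponent N / 2 will be the order mu. *)
Lemma hyp2F1_euler a b c x N : 0 <= a -> 0 <= b -> b <= c -> 0 < c ->
  c - a - b = N%:R / 2 -> 0 <= x < 1 ->
  hyp2F1 (c - a) (c - b) c x = (1 - x) `^ (- (N%:R / 2)) * hyp2F1 a b c x.
Proof.
move=> a0 b0 bc c0 cN x01; have /andP[x0 x1] := x01.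
have cv := gauss_series_bound a0 b0 bc c0 x01.
have t0 n : 0 <= gauss_coef a b c n * x ^+ n.
  by rewrite mulr_ge0 ?exprn_ge0 ?divr_ge0 ?mulr_ge0 ?pochhammer_ge0 // ltW.
have b0' n : 0 <= binomial_coef (N%:R / 2) n * x ^+ n.
  by rewrite mulr_ge0 ?exprn_ge0 ?binomial_coef_ge0 ?divr_ge0.
have hb := @binomial_series_half N _ x01.
rewrite mulrC; apply: has_sum_lim.
apply: eq_has_sum (cauchy_product _ _ (has_sum_is_cvg cv) hb) => [n||].
- rewrite -/(gauss_coef _ _ _ _) -saalschutz // cN mulr_suml.
  apply: eq_big_nat => i /andP[_]; rewrite ltnS => ni.
  have -> : x ^+ n = x ^+ i * x ^+ (n - i) by rewrite -exprD subnKC.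
  by move: (binomial_coef _ _) (gauss_coef _ _ _ _) => *; ring.
- by under eq_fun do rewrite ger0_norm //.
- by under eq_fun do rewrite ger0_norm //; apply/cvg_ex; eexists; exact: hb.
Qed.

End HypergeometricSeries.

(** * The addition theorem *)

Section AdditionTheorem.
Context {R : realType}.
Implicit Types (a n k N : nat) (c mu x y z s : R).

(* For z > 1 this series sums to z^-a times the Gauss series of parameters a/2,
   (a + 1)/2, c at 1/z^2. *)
Definition legendre_term a c z k : R :=
  pochhammer a%:R k.*2 / (4 ^+ k * k`!%:R * pochhammer c k) / z ^+ (a + k.*2).

Definition legendre_sum a c z : R := limn (series (legendre_term a c z)).

(** Since (2 k)! = 4^k k! (1/2)_k, replacing mu + 1/2 by the smaller 1/2 turns the left side into
    the part of (A + B)^N / N! that is even in B. *)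
Lemma sum_even_binomial_le mu N (A B : R) : 0 < mu -> 0 <= A -> 0 <= B ->
  \sum_(0 <= k < N./2.+1) A ^+ (N - k.*2) * B ^+ k.*2
    / (4 ^+ k * k`!%:R * (N - k.*2)`!%:R * pochhammer (mu + 2^-1) k)
  <= (A + B) ^+ N / N`!%:R.
Proof.
move=> mu0 A0 B0.
have f0 n : n`!%:R != 0 :> R by rewrite pnatr_eq0 -lt0n fact_gt0.
have f0' n : 0 < n`!%:R :> R by rewrite ltr0n fact_gt0.
pose F j : R := A ^+ j * B ^+ (N - j) / (j`!%:R * (N - j)`!%:R).
have F0 j : 0 <= F j by rewrite divr_ge0 ?mulr_ge0 ?exprn_ge0.
have -> : (A + B) ^+ N / N`!%:R = \sum_(0 <= j < N.+1) F j.
  rewrite addrC exprDn big_mkord mulr_suml; apply: eq_bigr => -[j /= jN] _.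
  rewrite ltnS in jN; rewrite -mulr_natr -(bin_fact jN) !natrM /F [B ^+ _ * _]mulrC.
  have : 'C(N, j)%:R != 0 :> R by rewrite pnatr_eq0 -lt0n bin_gt0.
  move: (f0 j) (f0 (N - j)%N) => *; field; do ?[apply/andP; split] => //.
apply: le_trans (_ : \sum_(0 <= j < N.+1 | ~~ odd (N - j)) F j <= _); last first.
  by rewrite big_mkcond ler_sum // => j _; case: ifP.
rewrite sum_even_gap ler_sum_nat // => k /andP[_ kN].
have kN' : (k.*2 <= N)%N by lia.
rewrite /F subKn // ler_wpM2l ?mulr_ge0 ?exprn_ge0 //.
rewrite lef_pV2 ?posrE ?mulr_gt0 ?exprn_gt0 ?pochhammer_gt0 ?addr_gt0 ?invr_gt0 //.
have -> : k.*2`!%:R = 4 ^+ k * k`!%:R * pochhammer 2^-1 k :> R.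
  rewrite -pochhammer1 pochhammer_double mul1r divff // pochhammer1.
  by rewrite mulrAC.
rewrite [leRHS]mulrAC [leLHS]mulrC ler_wpM2r ?ler_wpM2l ?mulr_ge0 ?exprn_ge0 //.
by rewrite ler_pochhammer ?invr_ge0 // lerDr ltW.
Qed.

Lemma horner_gegenbauer_avg mu x y s N : s ^+ 2 = (1 - x ^+ 2) * (1 - y ^+ 2) ->
  (gegenbauer_avg mu y N).[x] =
  \sum_(0 <= k < N./2.+1) (x * y) ^+ (N - k.*2) * s ^+ k.*2
    / (4 ^+ k * k`!%:R * (N - k.*2)`!%:R * pochhammer (mu + 2^-1) k).
Proof.
move=> sE; rewrite horner_sum; apply: eq_bigr => k _.
rewrite hornerZ hornerM horner_exp hornerD hornerN !hornerXn hornerC.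
by rewrite -mul2n exprM sE !exprMn; ring.
Qed.

(** On the diagonal x y + s is x^2 + (1 - x^2) = 1. *)
Lemma gegenbauer_avg_diag_le mu x N : 0 < mu -> x ^+ 2 <= 1 ->
  (gegenbauer_avg mu x N).[x] <= N`!%:R^-1.
Proof.
move=> mu0 x1; rewrite (@horner_gegenbauer_avg _ _ _ (1 - x ^+ 2)) ?expr2 //.
apply: le_trans (sum_even_binomial_le _ mu0 _ _) _; rewrite ?subr_ge0 ?sqr_ge0 //.
by rewrite addrC subrK expr1n mul1r.
Qed.

Definition gegenbauer_product mu x y n : R :=
  n`!%:R / (2 ^+ n * pochhammer mu n * pochhammer (2 * mu) n)
  * gegenbauer n mu x * gegenbauer n mu y.

Lemma horner_gegenbauer_avgE mu x y N : 0 < mu ->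
  (gegenbauer_avg mu y N).[x] = \sum_(0 <= k < N./2.+1)
    gegenbauer_product mu x y (N - k.*2)
    / (4 ^+ k * k`!%:R * pochhammer (mu + (N - k.*2)%:R + 1) k).
Proof.
move=> mu0; rewrite gegenbauer_avgE // horner_sum; apply: eq_bigr => k _.
by rewrite hornerZ horner_gegenbauer_poly /gegenbauer_product; ring.
Qed.

(** A nonnegative weight times 2 |A B| <= A^2 + B^2. The diagonal products on the right are
    nonnegative, so their sums need no absolute values and are averages again. *)
Lemma norm_gegenbauer_product_le mu x y n : 0 < mu ->
  `|gegenbauer_product mu x y n| <=
  (gegenbauer_product mu x x n + gegenbauer_product mu y y n) / 2.
Proof.
move=> mu0; rewrite /gegenbauer_product; set d := _ / _.
have d0 : 0 <= d by rewrite divr_ge0 ?mulr_ge0 ?pochhammer_ge0 ?mulr_ge0 // ltW.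
set A := gegenbauer n mu x; set B := gegenbauer n mu y.
have -> : (d * A * A + d * B * B) / 2 = d * ((A * A + B * B) / 2) by ring.
rewrite -mulrA normrM ger0_norm // ler_wpM2l // ler_norml.
by apply/andP; split; [have := sqr_ge0 (A + B)|have := sqr_ge0 (A - B)]; nra.
Qed.

Lemma sum_norm_gegenbauer_product_le mu x y N :
  0 < mu -> x ^+ 2 <= 1 -> y ^+ 2 <= 1 ->
  \sum_(0 <= k < N./2.+1) `|gegenbauer_product mu x y (N - k.*2)|
    / (4 ^+ k * k`!%:R * pochhammer (mu + (N - k.*2)%:R + 1) k) <= N`!%:R^-1.
Proof.
move=> mu0 x1 y1.
apply: le_trans (_ : ((gegenbauer_avg mu x N).[x] + (gegenbauer_avg mu y N).[y]) / 2 <= _).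
  rewrite !horner_gegenbauer_avgE // -big_split mulr_suml ler_sum // => k _ /=.
  rewrite -mulrDl [leRHS]mulrAC ler_wpM2r ?norm_gegenbauer_product_le //.
  by rewrite invr_ge0 !mulr_ge0 ?exprn_ge0 ?pochhammer_ge0 ?addr_ge0 // ltW.
by rewrite ler_pdivrMr // mulr_natr mulr2n lerD ?gegenbauer_avg_diag_le.
Qed.

(** Cauchy-Schwarz for the unit vectors (|x|, sqrt(1 - x^2)) and (|y|, sqrt(1 - y^2)). It keeps the
    powers of |x y| + s bounded and the successive arguments of the kernel above 1. *)
Lemma norm_mul_add_sqrt_le1 x y s : 0 <= s -> x ^+ 2 <= 1 -> y ^+ 2 <= 1 ->
  s ^+ 2 = (1 - x ^+ 2) * (1 - y ^+ 2) -> `|x * y| + s <= 1.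
Proof.
move=> s0 x1 y1 sE.
have X1 : `|x| <= 1 by rewrite -(@ler_pXn2r _ 2) ?nnegrE // real_normK ?num_real // expr1n.
have Y1 : `|y| <= 1 by rewrite -(@ler_pXn2r _ 2) ?nnegrE // real_normK ?num_real // expr1n.
have X2 : `|x| ^+ 2 = x ^+ 2 by rewrite real_normK ?num_real.
have Y2 : `|y| ^+ 2 = y ^+ 2 by rewrite real_normK ?num_real.
rewrite normrM addrC -lerBrDr.
have p1 : `|x| * `|y| <= 1 by rewrite mulr_ile1.
rewrite -(@ler_pXn2r _ 2) ?nnegrE ?subr_ge0 // sE -X2 -Y2 -subr_ge0.
suff -> : (1 - `|x| * `|y|) ^+ 2 - (1 - `|x| ^+ 2) * (1 - `|y| ^+ 2)
  = (`|x| - `|y|) ^+ 2 by exact: sqr_ge0.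
by ring.
Qed.

Lemma sum_binomial_pow_bound a z : 1 < z -> exists K, forall M,
  \sum_(0 <= N < M) pochhammer a%:R N / z ^+ (a + N) * N`!%:R^-1 <= K.
Proof.
move=> z1; have z0 : 0 < z by apply: lt_trans z1.
have zz : `|z^-1| < 1 by rewrite ger0_norm ?invr_ge0 ?ltW // invf_lt1.
have /has_sumZ h := @binomial_series_nat _ a _ zz.
exists (z ^- a * (1 - z^-1) ^- a) => M; apply: le_trans (series_le_has_sum M _ (h (z ^- a))).
  rewrite /series /= ler_sum // => N _; rewrite exprD invfM /binomial_coef exprVn.
  by rewrite le_eqVlt; apply/orP; left; apply/eqP; ring.
have zV : 0 <= z^-1 by rewrite invr_ge0 ltW.
move=> n; rewrite -exprVn mulr_ge0 ?exprn_ge0 // mulr_ge0 ?exprn_ge0 //.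
exact: binomial_coef_ge0.
Qed.

(** The series [diag] is read along two double arrays with the same diagonals. One expands the
    average in Gegenbauer products, and its row sums are the terms of the claim; the other expands
    it in powers of x y and s, and its rows are binomial series in x y / z that sum to powers of z -
    x y. *)
Lemma legendre_addition a mu x y s z : 0 < mu -> 0 < s -> x ^+ 2 <= 1 ->
  y ^+ 2 <= 1 -> s ^+ 2 = (1 - x ^+ 2) * (1 - y ^+ 2) -> 1 < z ->
  has_sum (fun n => pochhammer a%:R n * gegenbauer_product mu x y n
      * legendre_sum (a + n) (mu + n%:R + 1) z)
    (legendre_sum a (mu + 2^-1) ((z - x * y) / s) / s ^+ a).
Proof.
move=> mu0 s0 x1 y1 sE z1; have z0 : 0 < z by apply: lt_trans z1.
have [K bK] := sum_binomial_pow_bound a z1.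
pose diag N := pochhammer a%:R N / z ^+ (a + N) * (gegenbauer_avg mu y N).[x].
have p0 N : 0 <= pochhammer a%:R N / z ^+ (a + N).
  by rewrite divr_ge0 ?pochhammer_ge0 ?exprn_ge0 // ltW.
have xys : `|x * y| + s <= 1 by apply: norm_mul_add_sqrt_le1 => //; exact: ltW.
(* Row n collects the products of degree n. The index k of the average becomes the column j = 2 k,
   so that n + j is the total degree N and odd columns are 0. *)
pose t n j := if odd j then 0 else pochhammer a%:R (n + j) / z ^+ (a + (n + j)) *
  (gegenbauer_product mu x y n
    / (4 ^+ j./2 * j./2`!%:R * pochhammer (mu + n%:R + 1) j./2)).
have tdiag N (F : R -> R) : F 0 = 0 -> \sum_(0 <= i < N.+1) F (t i (N - i)%N) =
    \sum_(0 <= k < N./2.+1) F (pochhammer a%:R N / z ^+ (a + N) *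
  (gegenbauer_product mu x y (N - k.*2)
    / (4 ^+ k * k`!%:R * pochhammer (mu + (N - k.*2)%:R + 1) k))).
  move=> F0; pose G j := F (pochhammer a%:R N / z ^+ (a + N) *
  (gegenbauer_product mu x y j
    / (4 ^+ (N - j)./2 * (N - j)./2`!%:R * pochhammer (mu + j%:R + 1) (N - j)./2))).
  transitivity (\sum_(0 <= j < N.+1 | ~~ odd (N - j)) G j).
    rewrite [RHS]big_mkcond; apply: eq_big_nat => i /andP[_]; rewrite ltnS => iN.
    by rewrite /t subnKC // /G; case: ifP.
  rewrite sum_even_gap; apply: eq_big_nat => k /andP[_ kN].
  by rewrite /G subKn ?doubleK //; lia.
have [M|u [L [hu uL dL]]] := @triangular_fubini _ t K.
  apply: le_trans (bK M); rewrite ler_sum // => N _.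
  rewrite (tdiag N (fun v => `|v|)) ?normr0 //.
  under eq_bigr => k _.
    rewrite normrM (ger0_norm (p0 N)) normrM [X in _ * (_ * X)]ger0_norm; first over.
    by rewrite invr_ge0 !mulr_ge0 ?exprn_ge0 ?pochhammer_ge0 ?addr_ge0 // ltW.
  by rewrite -mulr_sumr ler_wpM2l // sum_norm_gegenbauer_product_le.
have {}dL : has_sum diag L.
  apply: eq_has_sum dL => N; rewrite (tdiag N id) // -mulr_sumr.
  by rewrite /diag horner_gegenbauer_avgE.
have uE n : u n = pochhammer a%:R n * gegenbauer_product mu x y n
      * legendre_sum (a + n) (mu + n%:R + 1) z.
  have hn : has_sum (fun k => t n k.*2) (u n).
    apply: has_sum_even (hu n) => j; rewrite /t; case: ifP => // /negbT oj.
    by rewrite odd_double even_halfK // doubleK.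
  rewrite /legendre_sum; apply: has_sumZ_lim.
  apply: eq_has_sum hn => k; rewrite /t odd_double doubleK /legendre_term.
  by rewrite pochhammerD addnA natrD; ring.
(* Rows follow the exponent j of s and columns the exponent i of x y. In row j = 2 k, splitting
   (a)_(2k+i) as (a)_2k (a + 2k)_i exposes the binomial series of exponent a + 2 k. *)
pose t' j i := if odd j then 0 else pochhammer a%:R (j + i) / z ^+ (a + (j + i)) *
  ((x * y) ^+ i * s ^+ j
    / (4 ^+ j./2 * j./2`!%:R * i`!%:R * pochhammer (mu + 2^-1) j./2)).
have tdiag' N (F : R -> R) : F 0 = 0 -> \sum_(0 <= i < N.+1) F (t' i (N - i)%N) =
    \sum_(0 <= k < N./2.+1) F (pochhammer a%:R N / z ^+ (a + N) *
  ((x * y) ^+ (N - k.*2) * s ^+ k.*2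
    / (4 ^+ k * k`!%:R * (N - k.*2)`!%:R * pochhammer (mu + 2^-1) k))).
  move=> F0; pose G j := F (pochhammer a%:R N / z ^+ (a + N) *
  ((x * y) ^+ j * s ^+ (N - j)
    / (4 ^+ (N - j)./2 * (N - j)./2`!%:R * j`!%:R * pochhammer (mu + 2^-1) (N - j)./2))).
  transitivity (\sum_(0 <= j < N.+1 | ~~ odd (N - j)) G j).
    rewrite [RHS]big_mkcond big_nat_rev /=; apply: eq_big_nat => i /andP[_].
    rewrite ltnS => iN; rewrite add0n subSS subKn // /t' subnK // /G.
    by case: ifP.
  rewrite sum_even_gap; apply: eq_big_nat => k /andP[_ kN].
  by rewrite /G subKn ?doubleK //; lia.
have [M|u' [L' [hu' uL' dL']]] := @triangular_fubini _ t' K.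
  apply: le_trans (bK M); rewrite ler_sum // => N _.
  rewrite (tdiag' N (fun v => `|v|)) ?normr0 //.
  under eq_bigr => k _.
    rewrite normrM (ger0_norm (p0 N)) normrM [X in _ * (_ * X)]ger0_norm; last first.
      rewrite invr_ge0 !mulr_ge0 ?exprn_ge0 ?pochhammer_ge0 ?addr_ge0 ?invr_ge0 //.
      exact: ltW.
    rewrite normrM !normrX (gtr0_norm s0); over.
  rewrite -mulr_sumr ler_wpM2l //.
  apply: le_trans (sum_even_binomial_le _ mu0 _ _) _ => //; first exact: ltW.
  by rewrite -[leRHS]mul1r ler_wpM2r ?invr_ge0 // exprn_ile1 // addr_ge0 // ltW.
have {}dL' : has_sum diag L'.
  apply: eq_has_sum dL' => N; rewrite (tdiag' N id) // -mulr_sumr.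
  by rewrite /diag (horner_gegenbauer_avg _ _ sE).
have LL : L' = L by apply: has_sum_unique dL' dL.
rewrite LL in uL'.
have xyz : x * y < z.
  by apply: le_lt_trans z1; apply: le_trans (ler_norm _) _; apply: le_trans xys; rewrite lerDl ltW.
have h : has_sum (fun k => legendre_term a (mu + 2^-1) ((z - x * y) / s) k) (L * s ^+ a).
  have hs : has_sum (fun k => u' k.*2) L.
    apply: has_sum_even uL' => j; case: ifPn => [oj|ej]; last by rewrite even_halfK.
    apply: has_sum_unique (hu' j) _; rewrite /t' oj.
    rewrite /has_sum (_ : series _ = (fun=> 0)); first exact: cvg_cst.
    by apply/funext => n; rewrite /series /= big1.
  rewrite [L * _]mulrC.
  apply: (@eq_has_sum _ (fun k => s ^+ a * u' k.*2)) => [k|]; last exact: has_sumZ.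
  have xyz1 : `|x * y / z| < 1.
    rewrite normrM normfV (gtr0_norm z0) ltr_pdivrMr // mul1r.
    by apply: le_lt_trans z1; apply: le_trans xys; rewrite lerDl ltW.
  have hk := @has_sumZ _ (pochhammer a%:R k.*2 / z ^+ (a + k.*2) *
    (s ^+ k.*2 / (4 ^+ k * k`!%:R * pochhammer (mu + 2^-1) k))) _ _
    (@binomial_series_nat _ (a + k.*2) _ xyz1).
  rewrite (has_sum_unique (hu' k.*2) (eq_has_sum _ hk)) => [|i]; last first.
    rewrite /t' odd_double doubleK /binomial_coef pochhammerD natrD expr_div_n.
    rewrite addnA [z ^+ (_ + i)]exprD; move: (z ^+ (a + k.*2)) => W.
    by rewrite !invfM; ring.
  have -> : 1 - x * y / z = (z - x * y) / z by rewrite mulrBl divff ?lt0r_neq0.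
  rewrite /legendre_term !expr_div_n !invfM !invrK.
  have zz : z ^+ (a + k.*2) != 0 by rewrite expf_neq0 ?lt0r_neq0.
  have -> : s ^+ (a + k.*2) = s ^+ a * s ^+ k.*2 by rewrite exprD.
  move: (z ^+ (a + k.*2)) zz => W W0.
  set A := pochhammer _ _; set B := pochhammer _ _.
  transitivity (W^-1 * W * (s ^+ a * (A * (s ^+ k.*2 / (4 ^+ k * k`!%:R * B)))
    / (z - x * y) ^+ (a + k.*2))).
    by rewrite !invfM; move: (4 ^+ k)^-1 => *; ring.
  by rewrite mulVf // mul1r !invfM; move: (4 ^+ k)^-1 => *; ring.
rewrite /legendre_sum (has_sum_lim h) mulfK ?expf_neq0 ?lt0r_neq0 //.
by apply: eq_has_sum uL.
Qed.

End AdditionTheorem.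

(** * Gamma at half-integers through Gaussian moments *)

Section GammaHalfIntegers.
Context {R : realType}.
Local Open Scope classical_set_scope.
Implicit Types (n k : nat) (u : R).
Local Notation mu := (@lebesgue_measure R).

Lemma continuous_gaussian_moment n : continuous (fun u : R => u ^+ n * gauss_fun u).
Proof.
move=> u; apply: cvgM; last exact: continuous_gauss_fun.
exact: exprn_continuous.
Qed.

Lemma ge0_FTC2y0 (f F : R -> R) (l : R) : (forall u, 0 <= u -> 0 <= f u) ->
  continuous f -> (forall u, is_derive u 1 F (f u)) -> F u @[u --> +oo%R] --> l ->
  (\int[mu]_(u in `[0%R, +oo[) (f u)%:E = (l - F 0)%:E)%E.
Proof.
move=> f0 cf dF Fl; rewrite (ge0_continuous_FTC2y f0 _ Fl) //.
- exact: continuous_subspaceT.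
- apply: cvg_at_right_filter; apply: differentiable_continuous.
  by apply/derivable1_diffP.
- by move=> u _; rewrite derive1E derive_val.
Qed.

Lemma exprn_le_expR n u : 0 <= u -> u ^+ n <= n`!%:R * expR u.
Proof.
move=> u0; case: n => [|n]; first by rewrite expr0 mul1r; have := expR_ge1Dx u; lra.
rewrite mulrC -ler_pdivrMr ?ltr0n ?fact_gt0 //.
by apply: le_trans (expR_ge1Dxn n u0); rewrite lerDr.
Qed.

(** From u^n <= n! e^u and u - u^2 <= 1 - u, the latter being (u - 1)^2 >= 0. *)
Lemma gaussian_moment_le n u : 0 <= u ->
  u ^+ n * gauss_fun u <= n`!%:R * expR 1 * expR (- u).
Proof.
move=> u0; apply: le_trans (_ : n`!%:R * expR u * gauss_fun u <= _).
  by rewrite ler_wpM2r ?gauss_fun_ge0 ?exprn_le_expR.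
rewrite /gauss_fun -!mulrA ler_wpM2l // -!expRD ler_expR.
by have := sqr_ge0 (u - 1); nra.
Qed.

Lemma is_derive_expRN u : is_derive u 1 (fun u : R => expR (- u)) (- expR (- u)).
Proof.
apply: is_derive_eq.
by rewrite mulrN1.
Qed.

Lemma continuous_expRN : continuous (fun u : R => expR (- u)).
Proof. by move=> u; apply: continuous_comp; [exact: opp_continuous|exact: continuous_expR]. Qed.

Lemma is_derive_gauss_fun u : is_derive u 1 (gauss_fun : R -> R) (- 2 * u * gauss_fun u).
Proof.
rewrite /gauss_fun.
apply: is_derive_eq.
by rewrite -[u%:A]/(u * 1); ring.
Qed.

Lemma integral_expRN : (\int[mu]_(u in `[0%R, +oo[) (expR (- u))%:E = 1)%E.
Proof.
apply: etrans; first apply: (@ge0_FTC2y0 _ (fun u => - expR (- u)) 0).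
- by move=> u _; exact: expR_ge0.
- exact: continuous_expRN.
- by move=> u; apply: is_derive_eq; rewrite mulrN1 opprK.
- by rewrite -oppr0; apply: cvgN; exact: cvgr_expR.
- by rewrite /= oppr0 expR0 opprK add0r.
Qed.

Definition gaussian_moment n : \bar R :=
  (\int[mu]_(u in `[0%R, +oo[) (u ^+ n * gauss_fun u)%:E)%E.

Lemma gaussian_moment0 : gaussian_moment 0 = (Num.sqrt pi / 2)%:E.
Proof.
rewrite /gaussian_moment -integral0y_gauss; apply: eq_integral => u _.
by rewrite expr0 mul1r.
Qed.

Lemma gaussian_moment1 : gaussian_moment 1 = (2^-1)%:E.
Proof.
rewrite /gaussian_moment.
apply: etrans; first apply: (@ge0_FTC2y0 _ (fun u => - (2^-1 * gauss_fun u)) 0).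
- by move=> u u0; rewrite mulr_ge0 ?gauss_fun_ge0.
- exact: continuous_gaussian_moment.
- move=> u; rewrite /gauss_fun; apply: is_derive_eq.
  by rewrite /GRing.scale /=; field.
- by rewrite -oppr0 -(mulr0 2^-1); apply: cvgN; apply: cvgMr; exact: cvg_gauss_fun.
- by rewrite /gauss_fun expr0n oppr0 expR0 mulr1 opprK add0r.
Qed.

(* The multiple K e^-u makes the derivative of the primitive nonnegative, so
   that no integrability has to be discussed. *)
Lemma gaussian_momentSS n :
  (2%:E * gaussian_moment n.+2 = n.+1%:R%:E * gaussian_moment n)%E.
Proof.
(* By [gaussian_moment_le] this constant makes K e^(-u) dominate (n + 1) u^n e^(-u^2), the only
   negative term of [f]. *)
pose K : R := n.+1`!%:R * expR 1.
have K0 : 0 <= K by rewrite mulr_ge0 ?expR_ge0.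
pose f u := 2 * (u ^+ n.+2 * gauss_fun u) + K * expR (- u)
  - n.+1%:R * (u ^+ n * gauss_fun u).
have f0 u : 0 <= u -> 0 <= f u.
  move=> u0; rewrite /f -addrA; apply: addr_ge0.
    by apply: mulr_ge0 => //; apply: mulr_ge0; [exact: exprn_ge0|exact: gauss_fun_ge0].
  rewrite subr_ge0 /K factS natrM -2!mulrA ler_wpM2l //.
  by rewrite mulrA gaussian_moment_le.
have cM c m : continuous (fun u => c * (u ^+ m * gauss_fun u)).
  by move=> u; apply: cvgM; [exact: cvg_cst|exact: continuous_gaussian_moment].
have cK : continuous (fun u => K * expR (- u)).
  by move=> u; apply: cvgM; [exact: cvg_cst|exact: continuous_expRN].
have cf : continuous f.
  by move=> u; apply: cvgB; [apply: cvgD; [exact: cM|exact: cK]|exact: cM].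
pose F u := - (u ^+ n.+1 * gauss_fun u) - K * expR (- u).
have dF u : is_derive u 1 F (f u).
  have dX : is_derive u 1 (fun u : R => u ^+ n.+1) (n.+1%:R * u ^+ n).
    have h := is_deriveX n.+1 (is_derive_id u (1 : R)); rewrite exprfctE in h.
    apply: (is_derive_eq h).
    by rewrite [LHS]mulr1 mulr_natl.
  have h := is_deriveB (is_deriveN (is_deriveM dX (is_derive_gauss_fun u)))
    (is_deriveZ K (is_derive_expRN u)).
  rewrite (_ : F = - ((fun u => u ^+ n.+1) * gauss_fun) - K \*: (fun u => expR (- u))) //.
  apply: (is_derive_eq h).
  rewrite /f /GRing.scale /= !exprS.
  by move: (u ^+ n) (expR (- u)) (n.+1%:R : R) (gauss_fun u) => *; ring.
have Fl : F u @[u --> +oo%R] --> 0.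
  rewrite -(subr0 0) -[X in X - _]oppr0 -[X in _ - X](mulr0 K).
  apply: cvgB; last by apply: cvgMr; exact: cvgr_expR.
  apply: cvgN; apply: (@squeeze_cvgr _ _ _ _ (cst 0) (fun u => K * expR (- u))).
  - near=> u; have u0 : 0 <= u by near: u; exact: nbhs_pinfty_ge.
    by rewrite mulr_ge0 ?exprn_ge0 ?gauss_fun_ge0 //= gaussian_moment_le.
  - exact: cvg_cst.
  - by rewrite -[X in _ --> X](mulr0 K); apply: cvgMr; exact: cvgr_expR.
have intf := ge0_FTC2y0 f0 cf dF Fl.
have F00 : 0 - F 0 = K by rewrite /F expr0n /= mul0r oppr0 expR0 mulr1; ring.
rewrite F00 in intf.
have g0 c m u : 0 <= c -> 0 <= u -> 0 <= c * (u ^+ m * gauss_fun u).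
  by move=> *; rewrite !mulr_ge0 ?exprn_ge0 ?gauss_fun_ge0.
have intM c m : 0 <= c -> (\int[mu]_(u in `[0%R, +oo[)
    (c * (u ^+ m * gauss_fun u))%:E = c%:E * gaussian_moment m)%E.
  move=> c0; under eq_integral do rewrite EFinM.
  rewrite ge0_integralZl //; last 1 first.
    by move=> u /=; rewrite in_itv /= andbT => u0; rewrite lee_fin mulr_ge0 ?exprn_ge0 ?gauss_fun_ge0.
  by apply/measurable_EFinP; apply: measurable_funTS; apply: continuous_measurable_fun; exact: continuous_gaussian_moment.
have intK : (\int[mu]_(u in `[0%R, +oo[) (K * expR (- u))%:E = K%:E)%E.
  under eq_integral do rewrite EFinM.
  rewrite ge0_integralZl // ?integral_expRN ?mule1 //.
  by apply/measurable_EFinP; apply: measurable_funTS; apply: continuous_measurable_fun; exact: continuous_expRN.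
have E : (2%:E * gaussian_moment n.+2 + K%:E = n.+1%:R%:E * gaussian_moment n + K%:E)%E.
  rewrite -{1}intK -intf -!intM // -!ge0_integralD //=; first last.
  all: try by apply/measurable_EFinP; apply: measurable_funTS; apply: continuous_measurable_fun.
  all: try by move=> u /=; rewrite in_itv /= andbT => u0; rewrite lee_fin ?g0 ?f0 ?mulr_ge0 ?expR_ge0.
  apply: eq_integral => u _; rewrite -!EFinD; congr _%:E.
  by rewrite /f; ring.
move: E; case: (2%:E * _)%E => [x| |]; case: (n.+1%:R%:E * _)%E => [y| |] //=.
by rewrite -!EFinD => -[/addIr ->].
Unshelve. all: by end_near.
Qed.

(** Also true of infinite x: a positive factor keeps it infinite, and [fine] sends both infinities
    to 0. *)
Lemma fine_mulr (c : R) (x : \bar R) : 0 < c -> fine (c%:E * x)%E = c * fine x.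
Proof.
by move=> c0; case: x => [x| |] //=; rewrite ?gt0_muley ?gt0_muleNy ?mulr0 // lte_fin.
Qed.

(** The substitution t = u^2, made between [0, n^2] and [0, n], after which n tends to infinity. *)
Lemma integral_half_power k :
  (\int[mu]_(t in `[0%R, +oo[) (Num.sqrt t ^+ k * expR (- t))%:E =
   2%:E * gaussian_moment k.+1)%E.
Proof.
pose G (t : R) := Num.sqrt t ^+ k * expR (- t).
(* The absolute value makes [H] nonnegative on the whole line, as the passage to the limit asks; it
   disappears for u >= 0. *)
pose H (u : R) := 2 * (`|u ^+ k.+1| * gauss_fun u).
pose F (u : R) := u ^+ 2.
have cG : continuous G.
  move=> t; apply: cvgM; last exact: continuous_expRN.
  apply: (continuous_comp (f := Num.sqrt) (g := fun x => x ^+ k)).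
    exact: sqrt_continuous.
  exact: exprn_continuous.
have cH : continuous H.
  move=> u; apply: cvgM; first exact: cvg_cst.
  apply: cvgM; last exact: continuous_gauss_fun.
  by apply: cvg_norm; exact: exprn_continuous.
have G0 t : 0 <= G t by rewrite mulr_ge0 ?exprn_ge0 ?sqrtr_ge0 ?expR_ge0.
have H0 u : 0 <= H u by rewrite !mulr_ge0 ?exprn_ge0 ?gauss_fun_ge0.
have F' : F^`() = (fun u => 2 * u).
  apply/funext => u; rewrite derive1E /F derive_val.
  by rewrite -[u%:A]/(u * 1); ring.
have cF' : continuous (fun u : R => 2 * u).
  by move=> u; apply: cvgM; [exact: cvg_cst|exact: cvg_id].
have cF : continuous F by exact: exprn_continuous.
have GH n : (\int[mu]_(t in `[0%R, (n ^ 2)%N%:R]) (G t)%:E =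
    \int[mu]_(u in `[0%R, n%:R]) (H u)%:E)%E.
  have -> : `[0%R, (n ^ 2)%N%:R] = `[F 0, F n%:R].
    by rewrite /F expr0n natrX.
  rewrite integration_by_substitution_increasing //.
  - apply: eq_integral => u; rewrite inE /= in_itv /= => /andP[u0 _].
    rewrite -[(_ * _) u]/(G (F u) * F^`()%classic u) F' /G /H /F /gauss_fun sqrtr_sqr !ger0_norm ?exprn_ge0 //.
    rewrite [u ^+ k.+1]exprS; congr _%:E.
    by move: (u ^+ k) (expR _) => *; ring.
  - move=> u v; rewrite !in_itv /= => /andP[u0 _] /andP[v0 _] uv.
    by rewrite ltr_pXn2r // ?nnegrE.
  - by rewrite F' => u _; exact: cF'.
  - by rewrite F'; apply/cvg_ex; exists (2 * 0); apply: cvg_at_right_filter; exact: cF'.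
  - by rewrite F'; apply/cvg_ex; exists (2 * n%:R); apply: cvg_at_left_filter; exact: cF'.
  - split; [|apply: cvg_at_right_filter; exact: cF|apply: cvg_at_left_filter; exact: cF].
    by move=> u _; exact: ex_derive.
  - exact: continuous_subspaceT.
have mG : measurable_fun setT G by exact: continuous_measurable_fun.
have mH : measurable_fun setT H by exact: continuous_measurable_fun.
have cvH := @ge0_cvgn_integral R mu _ H0 mH.
have cvG : (\int[mu]_(t in `[0%R, (n ^ 2)%N%:R]) (G t)%:E)%E @[n --> \oo] -->
    (\int[mu]_(t in `[0%R, +oo[) (G t)%:E)%E.
  apply: (cvg_comp (fun n => (n ^ 2)%N)
    (fun n => (\int[mu]_(t in `[0%R, n%:R]) (G t)%:E)%E));
    last exact: (@ge0_cvgn_integral R mu _ G0 mG).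
  move=> S [N _ NS]; exists N => // n /= Nn; apply: NS => /=.
  by apply: leq_trans Nn _; rewrite -mulnn; case: n => // n; rewrite leq_pmulr.
have -> : (\int[mu]_(t in `[0%R, +oo[) (G t)%:E =
    \int[mu]_(u in `[0%R, +oo[) (H u)%:E)%E.
  apply: cvg_unique cvG _ => //.
  by have := cvH; under eq_fun do rewrite -GH.
rewrite /gaussian_moment -ge0_integralZl //; last 2 first.
- by apply/measurable_EFinP; apply: measurable_funTS; apply: continuous_measurable_fun;
    exact: continuous_gaussian_moment.
- by move=> u /=; rewrite in_itv /= andbT => u0; rewrite lee_fin mulr_ge0 ?exprn_ge0 ?gauss_fun_ge0.
apply: eq_integral => u; rewrite inE /= in_itv /= andbT => u0.
by rewrite /H ger0_norm ?exprn_ge0.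
Qed.

(** For t > 0 the factor t^(k/2) is the k-th power of sqrt t. Arguments of the form k/2 + 1 keep the
    integrand continuous at 0, where the endpoint is added. *)
Lemma Gamma_moment k : Gamma (k.+2%:R / 2) = 2 * fine (gaussian_moment k.+1) :> R.
Proof.
rewrite -fine_mulr // -integral_half_power /Gamma /Rintegral; congr fine.
rewrite -integral_itv_obnd_cbnd; last first.
  apply/measurable_EFinP; apply: measurable_funTS; apply: continuous_measurable_fun.
  move=> t; apply: cvgM; last exact: continuous_expRN.
  apply: (continuous_comp (f := Num.sqrt) (g := fun x => x ^+ k)).
    exact: sqrt_continuous.
  exact: exprn_continuous.
apply: eq_integral => t; rewrite inE /= in_itv /= andbT => t0.
have -> : k.+2%:R / 2 - 1 = 2^-1 * k%:R :> R.
  by rewrite -[in LHS]addn2 natrD; field.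
by rewrite powRrM powR_mulrn ?powR_ge0 // powR12_sqrt // ltW.
Qed.

Lemma Gamma_1 : Gamma 1 = 1 :> R.
Proof.
have -> : 1 = 2%:R / 2 :> R by rewrite divff.
by rewrite Gamma_moment gaussian_moment1.
Qed.

Lemma Gamma_halfSS k : Gamma (k.+4%:R / 2) = k.+2%:R / 2 * Gamma (k.+2%:R / 2) :> R.
Proof.
rewrite !Gamma_moment.
have /(congr1 fine) := gaussian_momentSS k.+1; rewrite !fine_mulr // => ->.
by field.
Qed.

Lemma Gamma_3_2 : Gamma (3 / 2) = Num.sqrt pi / 2 :> R.
Proof.
rewrite Gamma_moment.
have /(congr1 fine) := gaussian_momentSS 0; rewrite !fine_mulr // => ->.
by rewrite gaussian_moment0 mul1r.
Qed.

Lemma Gamma_half_gt0 k : 0 < Gamma (k.+2%:R / 2) :> R.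
Proof.
elim/ltn_ind: k => -[|[|k]] IH.
- by rewrite divff // Gamma_1.
- by rewrite Gamma_3_2 divr_gt0 // sqrtr_gt0 pi_gt0.
- by rewrite Gamma_halfSS mulr_gt0 ?divr_gt0 // IH.
Qed.

Lemma Gamma_half_pochhammer k n :
  Gamma (k.+2%:R / 2 + n%:R) = pochhammer (k.+2%:R / 2) n * Gamma (k.+2%:R / 2) :> R.
Proof.
elim: n => [|n IH]; first by rewrite addr0 pochhammer0 mul1r.
have E m : k.+2%:R / 2 + m%:R = (k + m.*2).+2%:R / 2 :> R.
  by rewrite -addn2 -[in RHS]addn2 -muln2 !natrD natrM; field.
rewrite pochhammerS mulrAC -IH !E doubleS !addnS Gamma_halfSS.
by rewrite mulrC.
Qed.

Lemma Gamma_nat n : Gamma n.+1%:R = n`!%:R :> R.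
Proof.
have := Gamma_half_pochhammer 0 n; rewrite divff // Gamma_1 mulr1 pochhammer1 => <-.
by rewrite addrC natr1.
Qed.

(** Legendre's duplication formula at half-integers. *)
Lemma Gamma_half_duplication k :
  Gamma (k.+3%:R / 2) * Gamma (k.+2%:R / 2) =
  Num.sqrt pi * k.+1`!%:R / 2 ^+ k.+1 :> R.
Proof.
elim: k => [|k IH]; first by rewrite Gamma_3_2 divff // Gamma_1 expr1 !mulr1.
rewrite Gamma_halfSS mulrAC -mulrA IH.
rewrite [in RHS]factS natrM [in RHS]exprS.
have : 2 ^+ k.+1 != 0 :> R by rewrite expf_neq0.
by move: (2 ^+ k.+1 : R) (k.+2%:R : R) => A B *; field.
Qed.

End GammaHalfIntegers.

(** * Legendre functions and one summation step *)

Section LegendreQ.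
Context {R : realType}.
Implicit Types (al N l n e p d j : nat) (z w t : R).

Lemma legendre_sum_hyp2F1 al c z : al%:R <= 2 * c -> 0 < c -> 1 < z ->
  legendre_sum al c z = z ^- al * hyp2F1 ((al%:R + 1) / 2) (al%:R / 2) c (1 / z ^+ 2).
Proof.
move=> alc c0 z1; have z0 : 0 < z by apply: lt_trans z1.
have z2 : 0 <= 1 / z ^+ 2 < 1.
  by rewrite divr_ge0 ?exprn_ge0 ?ltW //= ltr_pdivrMr ?exprn_gt0 // mul1r exprn_egt1.
have A0 : 0 <= (al%:R + 1) / 2 :> R by rewrite divr_ge0 ?addr_ge0.
have B0 : 0 <= al%:R / 2 :> R by rewrite divr_ge0.
have Bc : al%:R / 2 <= c by rewrite ler_pdivrMr // mulrC.
have h := @has_sumZ _ (z ^- al) _ _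
  (has_sum_is_cvg (gauss_series_bound A0 B0 Bc c0 z2)).
apply: has_sum_lim; apply: eq_has_sum h => k.
rewrite /legendre_term /gauss_coef pochhammer_double -!mul2n exprD exprM.
rewrite expr_div_n expr1n mul1r.
rewrite (_ : _ * _ / (4 ^+ k * _ * _) = 4 ^+ k / 4 ^+ k * (pochhammer (al%:R / 2) k
  * pochhammer ((al%:R + 1) / 2) k / (k`!%:R * pochhammer c k))); last first.
  by rewrite !invfM; move: (4 ^+ k)^-1 => *; ring.
by rewrite divff ?expf_neq0 // !invfM; ring.
Qed.

(* Euler's transformation turns the upper exponent nu + mu + 1 of the defining
   series into the lower one nu - mu + 1. *)
Lemma legendreQ_legendre_sum al N (nu mu c z : R) :
  nu = al%:R + N%:R / 2 - 1 -> mu = N%:R / 2 -> c = nu + 3 / 2 -> 1 < z ->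
  legendreQ nu mu z = cis (pi * mu) *
    (Num.sqrt pi * Gamma (al + N)%:R / (2 `^ (nu + 1) * Gamma c)
     * (z ^+ 2 - 1) `^ (- (mu / 2)) * legendre_sum al c z)%:C%C.
Proof.
move=> nuE muE cE z1; have z0 : 0 < z by apply: lt_trans z1.
have N0 : 0 <= N%:R :> R by [].
have al0 : 0 <= al%:R :> R by [].
have c0 : 0 < c by rewrite cE nuE; lra.
have alc : al%:R <= 2 * c by rewrite cE nuE; lra.
have z2 : 0 <= 1 / z ^+ 2 < 1.
  by rewrite divr_ge0 ?exprn_ge0 ?ltW //= ltr_pdivrMr ?exprn_gt0 // mul1r exprn_egt1.
have z21 : 0 < z ^+ 2 - 1 by rewrite subr_gt0 exprn_egt1.
rewrite /legendreQ -cE legendre_sum_hyp2F1 //; congr (_ * _%:C%C).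
have -> : (nu + mu + 1) / 2 = c - (al%:R + 1) / 2 by rewrite cE muE nuE; field.
have -> : (nu + mu + 2) / 2 = c - al%:R / 2 by rewrite cE muE nuE; field.
have A0 : 0 <= (al%:R + 1) / 2 :> R by rewrite divr_ge0 ?addr_ge0.
have B0 : 0 <= al%:R / 2 :> R by rewrite divr_ge0.
have Bc : al%:R / 2 <= c by rewrite ler_pdivrMr // mulrC.
(* Euler's exponent is mu = N / 2: its factor (1 - 1/z^2)^(-mu) turns the exponent mu/2 of z^2 - 1
   into - mu/2 and cancels the z^N in the denominator. *)
have cab : c - (al%:R + 1) / 2 - al%:R / 2 = N%:R / 2 by rewrite cE nuE; field.
rewrite (hyp2F1_euler A0 B0 Bc c0 cab z2).
have -> : nu + mu + 1 = (al + N)%:R by rewrite natrD muE nuE; field.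
rewrite powR_mulrn ?ltW // -muE.
have -> : 1 - 1 / z ^+ 2 = (z ^+ 2 - 1) / z ^+ 2.
  by rewrite mulrBl divff // expf_neq0 // lt0r_neq0.
have -> : ((z ^+ 2 - 1) / z ^+ 2) `^ (- mu) = (z ^+ 2 - 1) `^ (- mu) * z ^+ N.
  rewrite powRM ?invr_ge0 ?exprn_ge0 ?ltW //; congr (_ * _).
  rewrite -powR_inv1 ?exprn_ge0 ?ltW // -powRrM mulrN mulN1r opprK.
  rewrite -powR_mulrn ?ltW // -powRrM muE mulrC divfK // powR_mulrn // ltW //.
have -> : (z ^+ 2 - 1) `^ (- (mu / 2)) = (z ^+ 2 - 1) `^ (mu / 2) * (z ^+ 2 - 1) `^ (- mu).
  rewrite -powRD; first by congr (_ `^ _); field.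
  by rewrite (gt_eqF z21) implybT.
rewrite exprD; set P1 := _ `^ (mu / 2); set P2 := _ `^ (- mu); set h := hyp2F1 _ _ _ _.
have zN : z ^+ N != 0 by rewrite expf_neq0 // lt0r_neq0.
rewrite !invfM; transitivity (z ^+ N / z ^+ N * (Num.sqrt pi * Gamma (al + N)%:R *
   P1 * P2 * h / z ^+ al * (2 `^ (nu + 1))^-1 * (Gamma c)^-1)); first by ring.
by rewrite divff // mul1r; ring.
Qed.

(* Normalised so that the summation over l_j of the theorem, with j = d - 2 - e,
   turns the kernel of index e + 1 into the one of index e. *)
Definition addition_kernel p e l z : R :=
  (l - p).-1`!%:R / (2 ^+ l * Gamma ((l.*2 + e).+2%:R / 2))
  * legendre_sum (l - p) ((l.*2 + e).+2%:R / 2) z.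

(** The dimension is written e + 2: with e = d - 2 this covers the functions at zeta, with e = 0 the
    one at chi. *)
Lemma legendreQ_addition_kernel e p k z : (p < k)%N -> 1 < z ->
  let mu := p%:R + (e.+2%:R - 1) / 2 in
  legendreQ (k%:R + (e.+2%:R - 3) / 2) mu z = cis (pi * mu) *
    (Num.sqrt pi * ((p + k + e)`!%:R / (k - p).-1`!%:R) / 2 `^ ((e.+2%:R - 1) / 2)
     * (z ^+ 2 - 1) `^ (- (mu / 2)) * addition_kernel p e k z)%:C%C.
Proof.
move=> pk z1 mu.
have kE : k%:R = p%:R + (k - p)%:R :> R by rewrite -natrD subnKC // ltnW.
have NE : (2 * p + e.+1)%:R = 2 * p%:R + e%:R + 1 :> R.
  by rewrite natrD natrM -addn1 natrD; ring.
have eE : e.+2%:R = e%:R + 2 :> R by rewrite -addn2 natrD.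
rewrite (@legendreQ_legendre_sum (k - p) (2 * p + e.+1) _ mu ((k.*2 + e).+2%:R / 2) z) //.
- congr (_ * _%:C%C); rewrite /addition_kernel.
  have -> : ((k - p + (2 * p + e.+1)) = (p + k + e).+1)%N by lia.
  rewrite Gamma_nat.
  have -> : k%:R + (e.+2%:R - 3) / 2 + 1 = k%:R + (e.+2%:R - 1) / 2 :> R by field.
  rewrite powRD ?pnatr_eq0 ?implybT // powR_mulrn //.
  have : (k - p).-1`!%:R != 0 :> R by rewrite pnatr_eq0 -lt0n fact_gt0.
  move: ((k - p).-1`!%:R : R) => F F0; set G := Gamma _; set H := legendre_sum _ _ _.
  transitivity (F / F * (Num.sqrt pi * (p + k + e)`!%:R / 2 `^ ((e.+2%:R - 1) / 2)
    * (z ^+ 2 - 1) `^ (- (mu / 2)) / 2 ^+ k / G * H)); last by rewrite !invfM; ring.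
  by rewrite divff // !invfM; ring.
- by rewrite kE eE NE; field.
- by rewrite /mu eE NE; field.
- by rewrite -addn2 !natrD eE -muln2 natrM; field.
Qed.

(** In the product of the two factors the square root of the normalisation disappears. *)
Lemma Theta_product d j e l n t t' : (j + e.+2)%N = d ->
  let mu := (l.*2 + e).+1%:R / 2 in
  Theta d j (l + n) l t * Theta d j (l + n) l t' =
  (Gamma ((l.*2 + e).+3%:R / 2) / (l.*2 + e).+1%:R) ^+ 2
  * (2 ^+ (l.*2 + e).+1 * ((l + n).*2 + e).+1%:R * n`!%:R
     / (pi * (l.*2 + e + n)`!%:R))
  * (sin t * sin t') ^+ l * (gegenbauer n mu (cos t) * gegenbauer n mu (cos t')).
Proof.
move=> dE mu; rewrite /Theta.
have -> : (2 * l + d - j - 1 = (l.*2 + e).+1)%N by lia.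
have -> : (2 * (l + n) + d - j - 1 = ((l + n).*2 + e).+1)%N by lia.
have -> : (l + n - l = n)%N by lia.
have -> : (l + n + l + d - j - 2 = l.*2 + e + n)%N by lia.
have -> : l%:R + (d - j + 1)%N%:R / 2 = (l.*2 + e).+3%:R / 2 :> R.
  have -> : (d - j + 1 = e.+3)%N by lia.
  rewrite -[e.+3]addn3 -[(_ + e).+3]addn3 -muln2 !natrD natrM; by field.
have -> : l%:R + (d - j - 1)%N%:R / 2 = mu :> R.
  have -> : (d - j - 1 = e.+1)%N by lia.
  rewrite /mu -[e.+1]addn1 -[(_ + e).+1]addn1 -muln2 !natrD natrM; by field.
set q := (X in Num.sqrt X); have q0 : 0 <= q.
  by rewrite divr_ge0 ?mulr_ge0 ?exprn_ge0 ?pi_ge0.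
move: (Num.sqrt q) (sqr_sqrtr q0) => v vq; rewrite -/q -vq.
rewrite [(sin t * _) ^+ l]exprMn [v ^+ 2]expr2; move: (sin t ^+ l) (sin t' ^+ l) => *; ring.
Qed.

Lemma addition_kernel_step d j e p l t t' z : (j + e.+2)%N = d -> (p < l)%N ->
  0 < sin t -> 0 < sin t' -> 1 < z ->
  has_sum (fun n => Theta d j (l + n) l t * Theta d j (l + n) l t'
      * addition_kernel p e.+1 (l + n) z)
    ((sin t * sin t') ^+ p / Num.sqrt pi
     * addition_kernel p e l ((z - cos t * cos t') / (sin t * sin t'))).
Proof.
move=> dE pl st st' z1; set s := sin t * sin t'.
have s0 : 0 < s by rewrite mulr_gt0.
pose mu : R := (l.*2 + e).+1%:R / 2.
have mu0 : 0 < mu by rewrite divr_gt0.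
have c1 (u : R) : cos u ^+ 2 <= 1 by rewrite -(cos2Dsin2 u) lerDl sqr_ge0.
have c2 (u : R) : 1 - cos u ^+ 2 = sin u ^+ 2 by rewrite -(cos2Dsin2 u) addrAC subrr add0r.
have sE : s ^+ 2 = (1 - cos t ^+ 2) * (1 - cos t' ^+ 2) by rewrite !c2 -exprMn.
have sqpi : Num.sqrt pi != 0 :> R by rewrite lt0r_neq0 // sqrtr_gt0 pi_gt0.
have pi0 : Num.sqrt pi * Num.sqrt pi = pi :> R by rewrite -expr2 sqr_sqrtr ?pi_ge0.
(* The prefactor of the kernel at l, times 1 / sqrt pi and the s^l carried by the two [Theta]
   factors; the denominator s^(l-p) of the addition theorem leaves s^p. *)
pose k0 := s ^+ l / Num.sqrt pi * (l - p).-1`!%:R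
  / (2 ^+ l * Gamma ((l.*2 + e).+2%:R / 2)).
have := @has_sumZ _ k0 _ _ (@legendre_addition _ (l - p) _ _ _ _ _ mu0 s0 (c1 t) (c1 t') sE z1).
have -> : mu + 2^-1 = (l.*2 + e).+2%:R / 2.
  by rewrite /mu -[in RHS]addn1 -addSn natrD; field.
have -> : k0 * (legendre_sum (l - p) ((l.*2 + e).+2%:R / 2) ((z - cos t * cos t') / s) /
    s ^+ (l - p)) = s ^+ p / Num.sqrt pi
     * addition_kernel p e l ((z - cos t * cos t') / s).
  have sl : s ^+ l = s ^+ p * s ^+ (l - p) by rewrite -exprD subnKC // ltnW.
  rewrite /k0 /addition_kernel sl.
  have : s ^+ (l - p) != 0 by rewrite expf_neq0 // lt0r_neq0.
  move: (s ^+ (l - p)) => S S0; move: (legendre_sum _ _ _) => H.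
  transitivity (S / S * (s ^+ p / Num.sqrt pi * ((l - p).-1`!%:R /
    (2 ^+ l * Gamma ((l.*2 + e).+2%:R / 2)) * H))); last by rewrite divff // mul1r.
  by rewrite !invfM; ring.
apply: eq_has_sum => n; rewrite (Theta_product _ _ _ _ dE) /addition_kernel -/mu -/s.
have -> : (l + n - p = l - p + n)%N by lia.
have -> : ((l + n).*2 + e.+1).+2%:R / 2 = mu + n%:R + 1 :> R.
  have -> : (((l + n).*2 + e.+1).+2 = (l.*2 + e).+1 + n.*2 + 2)%N by lia.
  by rewrite /mu !natrD -(muln2 n) natrM; field.
rewrite /gegenbauer_product.
move: (legendre_sum _ _ _) (gegenbauer _ _ _) (gegenbauer _ _ _) => H C C'.
rewrite (@fact_pochhammer R (l - p) n) ?subn_gt0 //.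
have -> : (l.*2 + e + n = ((l.*2 + e).+1 + n).-1)%N by lia.
rewrite (@fact_pochhammer R (l.*2 + e).+1 n) //=.
have -> : (2 * mu = (l.*2 + e).+1%:R) by rewrite /mu; field.
have -> : Gamma (mu + n%:R + 1) =
    pochhammer (mu + 1) n * Gamma ((l.*2 + e).+3%:R / 2) :> R.
  have -> : mu + 1 = (l.*2 + e).+3%:R / 2.
    by rewrite /mu -[in RHS]addn2 -addSn natrD; field.
  rewrite -Gamma_half_pochhammer; congr Gamma.
  by rewrite /mu -[in RHS]addn2 -addSn natrD; field.
have P1 : mu * pochhammer (mu + 1) n = pochhammer mu n * (mu + n%:R).
  by rewrite -pochhammerSl pochhammerS.
have -> : ((l + n).*2 + e).+1%:R = 2 * (mu + n%:R).
  have -> : (((l + n).*2 + e).+1 = (l.*2 + e).+1 + n.*2)%N by lia.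
  by rewrite /mu !natrD -(muln2 n) natrM; field.
have N0 : (l.*2 + e).+1%:R = 2 * mu by rewrite /mu; field.
have f0 : (l.*2 + e)`!%:R != 0 :> R by rewrite pnatr_eq0 -lt0n fact_gt0.
have [e0 e1 e2] : [/\ 2 ^+ (l.*2 + e).+1 != 0 :> R, 2 ^+ l != 0 :> R & 2 ^+ n != 0 :> R].
  by rewrite !expf_neq0.
have q0 := pochhammer_neq0 n mu0.
have q2 : pochhammer ((l.*2 + e).+1%:R : R) n != 0 by rewrite pochhammer_neq0.
have m0 : mu + n%:R != 0 by rewrite lt0r_neq0 // ltr_wpDr.
have m1 : mu != 0 by rewrite lt0r_neq0.
have g2 := lt0r_neq0 (@Gamma_half_gt0 R (l.*2 + e)).
have -> : pochhammer (mu + 1) n = pochhammer mu n * (mu + n%:R) / mu.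
  by rewrite -P1 mulrC mulKf.
(* [Theta] brings this Gamma squared and the kernel at l + n divides by it once; duplication turns
   the remaining factor into the Gamma of [k0]. *)
have -> : Gamma ((l.*2 + e).+3%:R / 2) = Num.sqrt pi * (2 * mu * (l.*2 + e)`!%:R)
    / 2 ^+ (l.*2 + e).+1 / Gamma ((l.*2 + e).+2%:R / 2) :> R.
  by rewrite -N0 -natrM -factS -Gamma_half_duplication mulfK.
rewrite exprD /k0; move: q2; rewrite N0.
move: (pochhammer (l - p)%:R n) (Gamma _) g2 (pochhammer _ n) q0 (pochhammer _ n).
move: (mu + n%:R) m0 ((l - p).-1`!%:R : R) (n`!%:R : R).
move: ((l.*2 + e)`!%:R : R) f0 (2 ^+ (l.*2 + e).+1 : R) e0 (2 ^+ l : R) e1 (2 ^+ n : R) e2.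
move: (Num.sqrt pi) sqpi pi0 (s ^+ l) => r r0 <- S.
move=> F F0 P P0 P2 P20 P3 P30 A A0 B B' D G G0 Q Q0 Q' Q'0.
by field; do ?[apply/andP; split].
Qed.

End LegendreQ.

(** * The iterated series *)

Section IteratedSeries.
Context {R : realType}.
Implicit Types (d j k l n p : nat) (r x z w : R) (t : nat -> R).
Local Open Scope classical_set_scope.
Local Open Scope complex_scope.

Lemma cisDpin x n : cis (x + pi *+ n) = (-1) ^+ n * cis x :> R[i].
Proof.
elim: n => [|n IH]; first by rewrite mulr0n addr0 expr0 mul1r.
rewrite [pi *+ _]mulrSr addrA exprS -mulrA -IH /cis cosDpi sinDpi mulN1r.
by apply/eqP; rewrite eq_complex /= !eqxx.
Qed.

Lemma cvg_real_complex (c : R[i]) (u : nat -> R) (l : R) : u @ \oo --> l ->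
  (fun N => c * (u N)%:C : R[i]^o) @ \oo --> (c * l%:C : R[i]^o).
Proof.
move=> ul; apply: (@cvgMr R[i]^o) => //.
apply/cvgrPdist_lt => e e0.
(* In the order of R[i], 0 < e means that e is real and positive. *)
case: e e0 => er ei; rewrite ltcE /= => /andP[/eqP -> e0].
move/cvgrPdist_lt: ul => /(_ _ e0) ul; near=> N.
rewrite -rmorphB /= normc_def /= expr0n /= addr0 sqrtr_sqr ltcR.
by near: N.
Unshelve. all: by end_near.
Qed.

Lemma has_sum_shift (f : nat -> R) (l : nat) (s : R) :
  has_sum (fun n => f (l + n)%N) s -> (fun N => \sum_(l <= k < N) f k) @ \oo --> s.
Proof.
move=> h; rewrite (_ : (fun N => _) = (series (fun n => f (l + n)%N)) \o (fun N => N - l)%N).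
  by apply: (cvg_comp (fun N => N - l)%N (series _)); [exact: cvg_subnr|exact: h].
apply/funext => N; rewrite /series /= -{1}(add0n l) big_addn.
by apply: eq_bigr => i _; rewrite addnC.
Qed.

(* The argument of the kernel after n summations: it runs from zeta to chi. *)
Fixpoint poly_argument (t t' : nat -> R) (z : R) n : R :=
  if n is n'.+1 then
    (poly_argument t t' z n' - cos (t n) * cos (t' n)) / (sin (t n) * sin (t' n))
  else z.

Lemma poly_argument_gt1 t t' z n : (forall j, (1 <= j <= n)%N -> 0 < sin (t j)) ->
  (forall j, (1 <= j <= n)%N -> 0 < sin (t' j)) -> 1 < z ->
  1 < poly_argument t t' z n.
Proof.
elim: n => [|n IH] //= st st' z1.
have {}IH : 1 < poly_argument t t' z n.
  by apply: IH => // j /andP[j1 jn]; [apply: st|apply: st']; rewrite j1 ltnW.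
have s1 : 0 < sin (t n.+1) by apply: st; rewrite /= leqnn.
have s2 : 0 < sin (t' n.+1) by apply: st'; rewrite /= leqnn.
have c1 (u : R) : cos u ^+ 2 <= 1 by rewrite -(cos2Dsin2 u) lerDl sqr_ge0.
have c2 (u : R) : 1 - cos u ^+ 2 = sin u ^+ 2 by rewrite -(cos2Dsin2 u) addrAC subrr add0r.
rewrite ltr_pdivlMr ?mulr_gt0 // mul1r ltrBrDr; apply: le_lt_trans IH.
apply: le_trans (_ : `|cos (t n.+1) * cos (t' n.+1)| + sin (t n.+1) * sin (t' n.+1) <= _).
  by rewrite addrC lerD2r ler_norm.
apply: norm_mul_add_sqrt_le1 => //; first by rewrite ltW ?mulr_gt0.
by rewrite !c2 exprMn.
Qed.

(** Every level has a closed form, which supplies the inner sums as witnesses: n summations lower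
    the kernel index from d - 2 to d - 2 - n and collect one factor (sin sin')^p / sqrt pi each. *)
Lemma is_iterated_series_kernel d p n l t t' z (a : nat -> R[i]) (c : R[i]) :
  (forall j, (1 <= j <= d - 2)%N -> 0 < sin (t j)) ->
  (forall j, (1 <= j <= d - 2)%N -> 0 < sin (t' j)) -> 1 < z ->
  (forall k, (p < k)%N -> a k = c * (addition_kernel p (d - 2) k z)%:C) ->
  (n <= d - 2)%N -> (p < l)%N ->
  is_iterated_series (Omega d t t') a n l
    (c * (\prod_(1 <= j < n.+1) ((sin (t j) * sin (t' j)) ^+ p / Num.sqrt pi)
      * addition_kernel p (d - 2 - n) l (poly_argument t t' z n))%:C).
Proof.
move=> st st' z1 aE; elim: n l => [|n IH] l nd pl /=.
  by rewrite big_geq // mul1r subn0 aE.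
set K := \prod_(1 <= j < n.+1) _ in IH.
exists (fun k => c * (K * addition_kernel p (d - 2 - n) k (poly_argument t t' z n))%:C).
  by move=> k lk; apply: IH; [exact: ltnW|exact: leq_trans pl lk].
rewrite big_nat_recr //= -/K.
have z1' : 1 < poly_argument t t' z n.
  by apply: poly_argument_gt1 => // j /andP[j1 jn]; [apply: st|apply: st'];
    rewrite j1 (leq_trans jn) // ltnW.
have e1 : (d - 2 - n = (d - 2 - n.+1).+1)%N by lia.
have dE : (n.+1 + (d - 2 - n.+1).+2 = d)%N by lia.
have s1 : 0 < sin (t n.+1) by apply: st; rewrite nd.
have s2 : 0 < sin (t' n.+1) by apply: st'; rewrite nd.
have h := @has_sumZ _ K _ _ (addition_kernel_step dE pl s1 s2 z1').
pose f k := K * (Theta d n.+1 k l (t n.+1) * Theta d n.+1 k l (t' n.+1)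
  * addition_kernel p (d - 2 - n.+1).+1 k (poly_argument t t' z n)).
have H := @cvg_real_complex c _ _ (@has_sum_shift f l _ h).
rewrite -[K * _ * _]mulrA.
rewrite [X in X @ _ --> _](_ : _ = (fun N => c * (\sum_(l <= k < N) f k)%:C)).
  exact: H.
apply/funext => N; rewrite rmorph_sum mulr_sumr; apply: eq_bigr => k _.
rewrite /f /Omega e1 mulrCA -rmorphM /=; congr (_ * _%:C).
by rewrite mulrCA.
Qed.

End IteratedSeries.

(** * From zeta to chi in polyspherical coordinates *)

Section PolysphericalGeometry.
Context {R : realType}.
Implicit Types (d j k n : nat) (r phi : R) (t : nat -> R).

(** The sines are nonnegative on [0, pi], and one that vanished would make R = 0. *)
Lemma sin_gt0_polyR d r t : 0 < r -> 0 < polyR d r t ->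
  (forall j, (1 <= j <= d - 2)%N -> 0 <= t j <= pi) ->
  forall j, (1 <= j <= d - 2)%N -> 0 < sin (t j).
Proof.
move=> r0; rewrite /polyR pmulr_rgt0 // => /lt0r_neq0 P0 tpi j jd.
rewrite lt_neqAle sin_ge0_pi ?tpi // andbT eq_sym.
apply: contraNneq P0 => s0; rewrite prodf_seq_eq0; apply/hasP; exists j.
  by rewrite mem_index_iota; lia.
by rewrite s0 eqxx.
Qed.

(** After n steps the argument is the analogue of chi for the first n coordinates, with the radius
    left by n angles in place of R. Each step splits a squared radius A^2 into (A cos)^2 + (A
    sin)^2. *)
Lemma poly_argumentE r r' t t' n : 0 < r -> 0 < r' ->
  (forall j, (1 <= j <= n)%N -> 0 < sin (t j)) ->
  (forall j, (1 <= j <= n)%N -> 0 < sin (t' j)) ->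
  poly_argument t t' (zeta r r') n =
  ((r * \prod_(1 <= k < n.+1) sin (t k)) ^+ 2
   + (r' * \prod_(1 <= k < n.+1) sin (t' k)) ^+ 2
   + \sum_(1 <= i < n.+1) (r * (\prod_(1 <= k < i) sin (t k)) * cos (t i)
       - r' * (\prod_(1 <= k < i) sin (t' k)) * cos (t' i)) ^+ 2)
  / (2 * (r * \prod_(1 <= k < n.+1) sin (t k))
       * (r' * \prod_(1 <= k < n.+1) sin (t' k))).
Proof.
move=> r0 r0'; elim: n => [|n IH] st st' /=.
  by rewrite !big_geq // !mulr1 addr0.
rewrite {}IH; last 2 first.
- by move=> j /andP[j1 jn]; apply: st; rewrite j1 ltnW.
- by move=> j /andP[j1 jn]; apply: st'; rewrite j1 ltnW.
rewrite [\sum_(1 <= i < n.+2) _]big_nat_recr // ![\prod_(1 <= k < n.+2) _]big_nat_recr //=.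
have P0 : 0 < \prod_(1 <= k < n.+1) sin (t k).
  rewrite big_seq_cond prodr_gt0 // => j; rewrite mem_index_iota andbT => /andP[j1 jn].
  by apply: st; rewrite j1 ltnW.
have P0' : 0 < \prod_(1 <= k < n.+1) sin (t' k).
  rewrite big_seq_cond prodr_gt0 // => j; rewrite mem_index_iota andbT => /andP[j1 jn].
  by apply: st'; rewrite j1 ltnW.
have /lt0r_neq0 s0 : 0 < sin (t n.+1) by apply: st; rewrite /= leqnn.
have /lt0r_neq0 s0' : 0 < sin (t' n.+1) by apply: st'; rewrite /= leqnn.
move/lt0r_neq0: r0; move/lt0r_neq0: r0'; move/lt0r_neq0: P0; move/lt0r_neq0: P0'.
have := cos2Dsin2 (t n.+1); have := cos2Dsin2 (t' n.+1).
move: (\sum_(1 <= i < n.+1) _) => V.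
move: (\prod_(1 <= k < n.+1) sin (t k)) (\prod_(1 <= k < n.+1) sin (t' k)) => P P'.
move: (cos (t n.+1)) (sin (t n.+1)) s0 (cos (t' n.+1)) (sin (t' n.+1)) s0'.
move=> c s s0 c' s' s0' E' E P0' P0 r0' r0.
rewrite (mulrA r P s) (mulrA r' P' s').
have A0 : r * P != 0 by rewrite mulf_neq0.
have B0 : r' * P' != 0 by rewrite mulf_neq0.
move: (r * P) (r' * P') A0 B0 => A B A0 B0.
have -> : (A * s) ^+ 2 + (B * s') ^+ 2 + (V + (A * c - B * c') ^+ 2) =
    A ^+ 2 * (c ^+ 2 + s ^+ 2) + B ^+ 2 * (c' ^+ 2 + s' ^+ 2) + V - 2 * A * B * (c * c').
  by ring.
rewrite E E' !mulr1; move: (A ^+ 2 + B ^+ 2 + V) (c * c') => N cc.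
by field; do ?[apply/andP; split].
Qed.

Lemma chi_poly_argument d r r' phi phi' t t' : (2 <= d)%N -> 0 < r -> 0 < r' ->
  (forall j, (1 <= j <= d - 2)%N -> 0 < sin (t j)) ->
  (forall j, (1 <= j <= d - 2)%N -> 0 < sin (t' j)) ->
  chi (polyR d r t) (polyR d r' t')
    (polyspherical d r t phi) (polyspherical d r' t' phi') =
  poly_argument t t' (zeta r r') (d - 2).
Proof.
move=> d2 r0 r0' st st'; rewrite poly_argumentE // /chi /polyR.
have -> : ((d - 2).+1 = d.-1)%N by lia.
congr ((_ + _) / _); rewrite [RHS]big_add1 -[d.-1.-1]/(d.-2).
have -> : d.-2 = (d - 2)%N by lia.
rewrite (big_nat_widen 0 (d - 2) d) ?leq_subr // big_mkord.
apply: eq_bigr => i id2; rewrite !mxE /=.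
by rewrite id2.
Qed.

Lemma zeta_gt1 (r r' : R) : 0 < r -> 0 < r' -> r != r' -> 1 < zeta r r'.
Proof.
move=> r0 r0' rr; rewrite /zeta ltr_pdivlMr ?mulr_gt0 // mul1r -subr_gt0.
have -> : r ^+ 2 + r' ^+ 2 - 2 * r * r' = (r - r') ^+ 2 by ring.
by rewrite lt_neqAle sqr_ge0 andbT eq_sym sqrf_eq0 subr_eq0.
Qed.

End PolysphericalGeometry.

(** * The expansion: matching the constants *)

Unset Implicit Arguments.
Local Open Scope complex_scope.


Unset Implicit Arguments.
Local Open Scope complex_scope.

Theorem theorem7p5 (R : realType) (d p m : nat)
    (r r' phi phi' : R) (theta theta' : nat -> R) (x x' : 'rV[R]_d)
    (hd : (4 <= d)%N) (hd_even : ~~ odd d) (hm : (p + 1 <= m)%N)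
    (htheta : forall j : nat, (1 <= j <= d - 2)%N -> 0 <= theta j <= pi)
    (htheta' : forall j : nat, (1 <= j <= d - 2)%N -> 0 <= theta' j <= pi)
    (hphi : - pi <= phi < pi) (hphi' : - pi <= phi' < pi)
    (hx : x = polyspherical d r theta phi)
    (hx' : x' = polyspherical d r' theta' phi')
    (hr : 0 < r) (hr' : 0 < r')
    (hR : 0 < polyR d r theta) (hR' : 0 < polyR d r' theta')
    (hrr' : r != r') :
  let rho := polyR d r theta in
  let rho' := polyR d r' theta' in
  let z := zeta r r' in
  let c := chi rho rho' x x' in
  exists2 s : R[i],
    is_iterated_series (Omega d theta theta')
      (fun l : nat =>
         ((l - p - 1)`!%:R / (p + l + d - 2)`!%:R)%:C
         * legendreQ (l%:R + (d%:R - 3) / 2) (p%:R + (d%:R - 1) / 2) z)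
      (d - 2) m s
  & legendreQ (m%:R - 1 / 2) (p%:R + 1 / 2) c =
    ((-1) ^+ (d./2 - 1) * (2 * pi) ^+ (d./2 - 1)
     * (z ^+ 2 - 1) `^ (p%:R / 2 + (d%:R - 1) / 4)
     * (c ^+ 2 - 1) `^ (- (p%:R / 2) - 1 / 4)
     * ((p + m)`!%:R / (m - p - 1)`!%:R)
     * (r * r' / (rho * rho')) ^+ p)%:C * s.
Proof.
move=> rho rho' z c.
have st := sin_gt0_polyR hr hR htheta.
have st' := sin_gt0_polyR hr' hR' htheta'.
have z1 : 1 < z by apply: zeta_gt1.
have d2 : (2 <= d)%N by apply: leq_trans hd.
have pm : (p < m)%N by rewrite -addn1.
have cE : c = poly_argument theta theta' z (d - 2).
  by rewrite /c hx hx'; apply: chi_poly_argument.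
have c1 : 1 < c by rewrite cE; apply: poly_argument_gt1.
have ev n : (1 < n)%N -> ~~ odd n -> exists D, n = D.*2.+2.
  by case: n => [|[|n]] // _ /=; rewrite negbK => /even_halfK nE; exists n./2; rewrite nE.
(* D = d/2 - 1 is the exponent in the statement, and d - 2 = 2 D the number of summations. *)
have [D dE] := ev _ d2 hd_even.
have dE2 : (d - 2 = D.*2)%N by rewrite dE subn2.
have dE1 : d.-1 = D.*2.+1 by rewrite dE.
have dh : (d./2 - 1 = D)%N by rewrite dE subn1 /= doubleK.
have pkd k : (p + k + d - 2 = p + k + D.*2)%N by rewrite dE !addnS subn2.
have dR : d%:R = 2 * D%:R + 2 :> R.
  by rewrite dE -addn2 natrD -muln2 natrM mulrC.
pose nu0 : R := p%:R + (d%:R - 1) / 2.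
(* What does not depend on l in the summands; their factorials cancel those of
   [legendreQ_addition_kernel]. *)
pose C0 : R[i] := cis (pi * nu0) *
  (Num.sqrt pi / 2 `^ ((d%:R - 1) / 2) * (z ^+ 2 - 1) `^ (- (nu0 / 2)))%:C.
pose a l : R[i] := ((l - p - 1)`!%:R / (p + l + d - 2)`!%:R)%:C
  * legendreQ (l%:R + (d%:R - 3) / 2) nu0 z.
have aE k : (p < k)%N -> a k = C0 * (addition_kernel p (d - 2) k z)%:C.
  move=> pk; rewrite /a /C0 /nu0 dE2 pkd subn1 dE.
  rewrite (legendreQ_addition_kernel _ pk z1) mulrCA -[RHS]mulrA -!rmorphM /=.
  congr (_ * _%:C).
  have : (k - p).-1`!%:R != 0 :> R by rewrite pnatr_eq0 -lt0n fact_gt0.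
  have : (p + k + D.*2)`!%:R != 0 :> R by rewrite pnatr_eq0 -lt0n fact_gt0.
  move: ((p + k + D.*2)`!%:R : R) ((k - p).-1`!%:R : R) => F G F0 G0.
  move: (addition_kernel _ _ _ _) (_ `^ (- _)) (2 `^ _) => A B E.
  transitivity (F / F * (G / G) * (Num.sqrt pi / E * B * A)); first by ring.
  by rewrite !divff // !mul1r.
exists (C0 * (\prod_(1 <= j < (d - 2).+1) ((sin (theta j) * sin (theta' j)) ^+ p / Num.sqrt pi)
      * addition_kernel p (d - 2 - (d - 2)) m (poly_argument theta theta' z (d - 2)))%:C).
  by apply: is_iterated_series_kernel.
rewrite -cE subnn.
have -> : m%:R - 1 / 2 = m%:R + (2%:R - 3) / 2 :> R by field.
have -> : p%:R + 1 / 2 = p%:R + (2%:R - 1) / 2 :> R by field.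
rewrite (legendreQ_addition_kernel 0 pm c1) addn0.
(* The two orders differ by D; the sign that appears here is undone by the one in the statement. *)
have cisE : cis (pi * nu0) = (-1) ^+ D * cis (pi * (p%:R + (2%:R - 1) / 2)) :> R[i].
  rewrite -cisDpin; congr cis.
  by rewrite /nu0 dR -[pi *+ D]mulr_natr; field.
(* The sines multiply to R R' / (r r'), whose p-th power is the inverse of the one in the statement,
   and the 2 D factors sqrt pi make the pi^D that cancels against (2 pi)^D. *)
have prodE : \prod_(1 <= j < (d - 2).+1) ((sin (theta j) * sin (theta' j)) ^+ p / Num.sqrt pi)
   = (rho * rho' / (r * r')) ^+ p / pi ^+ D.
  rewrite big_split /= prodrXl; congr (_ * _).
    congr (_ ^+ _); rewrite big_split /= /rho /rho' /polyR dE2 -dE1.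
    by field; rewrite !lt0r_neq0.
  rewrite prodr_const_nat subn1 /= dE2 -mul2n exprM exprVn.
  by rewrite sqr_sqrtr ?pi_ge0 // exprVn.
rewrite prodE /C0 cisE dh subn1.
have E (A B C : R) (w : R[i]) :
    A%:C * ((-1) ^+ D * w * B%:C * C%:C) = w * ((-1) ^+ D * A * B * C)%:C.
  by rewrite !rmorphM rmorphXn rmorphN1 /=; ring.
rewrite E; congr (_ * _%:C).
have z20 : 0 < z ^+ 2 - 1 by rewrite subr_gt0 exprn_egt1.
have -> : p%:R / 2 + (d%:R - 1) / 4 = nu0 / 2 :> R by rewrite /nu0; field.
have -> : - (p%:R / 2) - 1 / 4 = - ((p%:R + (2%:R - 1) / 2) / 2) :> R by field.
have -> : (z ^+ 2 - 1) `^ (nu0 / 2) = ((z ^+ 2 - 1) `^ (- (nu0 / 2)))^-1.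
  by rewrite powRN invrK.
have -> : 2 `^ ((d%:R - 1) / 2) = 2 ^+ D * 2 `^ ((2%:R - 1) / 2) :> R.
  rewrite -powR_mulrn // -powRD ?pnatr_eq0 ?implybT //.
  by congr (_ `^ _); rewrite dR; field.
have W0 : (z ^+ 2 - 1) `^ (- (nu0 / 2)) != 0 by rewrite lt0r_neq0 ?powR_gt0.
have T0 : 2 `^ ((2%:R - 1) / 2) != 0 :> R by rewrite lt0r_neq0 ?powR_gt0.
have sgn : (-1) ^+ D * (-1) ^+ D = 1 :> R by rewrite -expr2 sqrr_sign.
have rat : (r * r' / (rho * rho')) ^+ p * (rho * rho' / (r * r')) ^+ p = 1.
  rewrite -exprMn (_ : _ * _ = 1) ?expr1n //.
  by field; rewrite !lt0r_neq0.
have pi0 : pi ^+ D != 0 :> R by rewrite expf_neq0 // lt0r_neq0 // pi_gt0.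
have two0 : 2 ^+ D != 0 :> R by rewrite expf_neq0.
have G0 : (m - p).-1`!%:R != 0 :> R by rewrite pnatr_eq0 -lt0n fact_gt0.
rewrite [(2 * pi) ^+ D]exprMn; move: pi0 two0 G0 W0 T0 sgn rat.
move: (pi ^+ D : R) (2 ^+ D : R) (addition_kernel p 0 m c) ((m - p).-1`!%:R : R).
move: ((p + m)`!%:R : R) (Num.sqrt pi : R) ((z ^+ 2 - 1) `^ (- (nu0 / 2))).
move: (2 `^ ((2%:R - 1) / 2) : R) ((c ^+ 2 - 1) `^ _).
move: ((r * r' / (rho * rho')) ^+ p) ((rho * rho' / (r * r')) ^+ p) ((-1) ^+ D : R).
move=> A B s T X F S W P Q K G P0 Q0 G0 W0 T0 ss AB.
transitivity (s * s * (A * B) * (S * (F / G) / T * X * K)).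
  by rewrite ss AB !mul1r.
by field; do ?[apply/andP; split].
Qed.
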